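(* Let $L,EI,H,E_cA_c,L_c>0$ and $n>0$ be constants, and put $$a=\frac{H}{EI},\qquad b=\frac{8n}{L}\cdot\frac{E_cA_c}{EI\,L_c},\qquad c=\frac{8n}{L}\,b,\qquad \lambda=\frac{L}{100}.$$ Consider the problem $$w''''(x)-\Big(a+b\int_0^L w(t)dt\Big)w''(x)+c\int_0^L w(t)dt=\frac{p(x)}{EI}\ \text{a.e. in }(0,L),\quad w(0)=w(L)=w''(0)=w''(L)=0,\tag{P'}$$ where $p\in L^1[0,L]$, $p\ge0$, $p\not\equiv0$, and $$\frac{p(x)}{EI}\le\Big[\lambda\frac{\pi^4}{L^4}+a\lambda\frac{\pi^2}{L^2}+2b\lambda^2\frac{\pi}{L}\Big]\sin\Big(\frac{\pi}{L}x\Big)+2\lambda c\frac{L}{\pi}\quad\text{a.e. in }(0,L).$$ Then $\alpha\equiv0$ is a lower solution and $\beta(x)=\frac{L}{100}\sin(\frac{\pi}{L}x)$ is an upper solution of (P'). If moreover $n\ge\frac{1}{15.32}$ and $$N:=c\Big(1+\frac{\pi^2}{800n}\Big)\le\frac{4M}{L^3}\sigma(\sqrt M L),\qquad\text{where } M:=a+\frac{cL^3}{400n\pi},$$ then the iterative sequences generated from $y_0\equiv0$ and from $y_0=\frac{L}{100}\sin(\frac{\pi}{L}x)$ both converge uniformly to the unique positive solution of (P') in $\{u\in C^2[0,L]:0\le u\le\beta,\ 0\ge u''\ge\beta''\}$.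
   Context: $\sigma(t):=\dfrac{3t^3}{6t\cosh t+6t-12\sinh t-t^3}$ for $t>0$. Solutions of (P') are in $W^{4,1}[0,L]$. A lower solution of (P') is $\alpha\in W^{4,1}[0,L]$ with $\alpha''''-(a+b\int_0^L\alpha)\alpha''+c\int_0^L\alpha\le p/EI$ a.e. and $\alpha(0)=\alpha(L)=\alpha''(0)=\alpha''(L)=0$; an upper solution has the reversed inequality. Note $M=a+2b\lambda L/\pi$ and $N=c+b\lambda\pi^2/L^2$. The iteration: $y_n\in W^{4,1}[0,L]$ is the unique solution of $y_n''''-My_n''+N\int_0^L y_n=\frac{p}{EI}+b\,y_{n-1}''\int_0^L y_{n-1}-2b\lambda\frac{L}{\pi}y_{n-1}''+b\lambda\frac{\pi^2}{L^2}\int_0^L y_{n-1}$ with $y_n(0)=y_n(L)=y_n''(0)=y_n''(L)=0$, $n\ge1$. (Physically, $n$ is the sag-span ratio, with $q/H=8n/L$.) *)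

(* Defs.v *)
From HB Require Import structures.
From mathcomp Require Import all_boot all_order all_algebra.
From mathcomp Require Import all_classical all_reals all_analysis.
Set Implicit Arguments. Unset Strict Implicit. Unset Printing Implicit Defensive.
Import Order.TTheory GRing.Theory Num.Theory.
Import numFieldNormedType.Exports.
Local Open Scope classical_set_scope.
Local Open Scope ring_scope.

Notation leb := (@lebesgue_measure _).

Definition int0 {R : realType} (x : R) (f : R -> R) : R :=
  \int[lebesgue_measure]_(t in `[0, x]) f t.

(* w belongs to W^{4,1}[0,L], with (classical) derivatives w1, w2, w3 on [0,L]
   (w, w', w'', w''' absolutely continuous) and weak fourth derivative w4 in L^1[0,L]:
   each is the integral of the next one. *)
Definition W41 {R : realType} (L : R) (w w1 w2 w3 w4 : R -> R) : Prop :=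
  (lebesgue_measure).-integrable `[0, L] (EFin \o w4) /\
  forall x, 0 <= x <= L ->
    [/\ w x = w 0 + int0 x w1,
        w1 x = w1 0 + int0 x w2,
        w2 x = w2 0 + int0 x w3 &
        w3 x = w3 0 + int0 x w4].

Definition hinged_bc {R : realType} (L : R) (w w2 : R -> R) : Prop :=
  w 0 = 0 /\ w L = 0 /\ w2 0 = 0 /\ w2 L = 0.

Definition Pop {R : realType} (a b c L : R) (w w2 w4 : R -> R) (x : R) : R :=
  w4 x - (a + b * int0 L w) * w2 x + c * int0 L w.

Definition is_solution {R : realType} (a b c EI L : R) (p : R -> R)
    (w : R -> R) : Prop :=
  exists w1 w2 w3 w4, W41 L w w1 w2 w3 w4 /\ hinged_bc L w w2 /\
    {ae lebesgue_measure, forall x, 0 < x < L ->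
       Pop a b c L w w2 w4 x = p x / EI}.

Definition is_lower_solution {R : realType} (a b c EI L : R) (p : R -> R)
    (w : R -> R) : Prop :=
  exists w1 w2 w3 w4, W41 L w w1 w2 w3 w4 /\ hinged_bc L w w2 /\
    {ae lebesgue_measure, forall x, 0 < x < L ->
       Pop a b c L w w2 w4 x <= p x / EI}.

Definition is_upper_solution {R : realType} (a b c EI L : R) (p : R -> R)
    (w : R -> R) : Prop :=
  exists w1 w2 w3 w4, W41 L w w1 w2 w3 w4 /\ hinged_bc L w w2 /\
    {ae lebesgue_measure, forall x, 0 < x < L ->
       Pop a b c L w w2 w4 x >= p x / EI}.

Definition coshR {R : realType} (t : R) : R := (expR t + expR (- t)) / 2.
Definition sinhR {R : realType} (t : R) : R := (expR t - expR (- t)) / 2.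

Definition sigma {R : realType} (t : R) : R :=
  3 * t ^+ 3 / (6 * t * coshR t + 6 * t - 12 * sinhR t - t ^+ 3).

Definition iteration {R : realType} (a b c EI L lam : R) (p : R -> R)
    (y y2 : nat -> R -> R) : Prop :=
  let M := a + 2 * b * lam * L / pi in
  let N := c + b * lam * pi ^+ 2 / L ^+ 2 in
  forall k : nat, exists w1 w3 w4, W41 L (y k) w1 (y2 k) w3 w4 /\
    ((0 < k)%N ->
      hinged_bc L (y k) (y2 k) /\
      {ae lebesgue_measure, forall x, 0 < x < L ->
        w4 x - M * y2 k x + N * int0 L (y k) =
          p x / EI + b * y2 k.-1 x * int0 L (y k.-1)
          - 2 * b * lam * (L / pi) * y2 k.-1 x
          + b * lam * (pi ^+ 2 / L ^+ 2) * int0 L (y k.-1)}).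

Definition unif_cv_on {R : realType} (L : R) (y : nat -> R -> R) (u : R -> R) :=
  forall eps : R, 0 < eps -> exists N : nat, forall k : nat, (N <= k)%N ->
    forall x, 0 <= x <= L -> `|y k x - u x| < eps.

(* Main.v *)
Require Import Defs.
From HB Require Import structures.
From mathcomp Require Import all_boot all_order all_algebra.
From mathcomp Require Import all_classical all_reals all_analysis.
From mathcomp Require Import measurable_realfun ring lra.
Import Order.TTheory GRing.Theory Num.Theory.
Import numFieldNormedType.Exports.
Local Open Scope classical_set_scope.
Local Open Scope ring_scope.

(** Put z = - w'', m = sqrt M, and let G be the Green function of - z'' + M z
    with Dirichlet conditions.  If w'''' - M w'' + N int w = h with hinged ends,
    then z(x) = int K(x, s) h(s) ds, where
      K(x, s) = G(x, s) - N (G 1)(x) (G psi)(s) / (1 + N int G psi)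
    and psi(s) = s (L - s) / 2.  The worst point is (x, s) -> (0, L), and
    N <= 4 M / L^3 sigma(m L) says exactly that K is nonnegative there: this is
    the maximum principle.  As h is only integrable, the integral of h >= 0
    against K is handled in Stieltjes form.

    By the maximum principle the iteration maps the sector
    {0 <= u <= beta, beta'' <= u'' <= 0} into itself.  Comparison with multiples
    of beta, on which the linear operator is explicit, shows that it contracts
    the distance inf {d | |y - z| <= d beta, |y'' - z''| <= d |beta''|} by the
    factor max (b I / (pi^2/L^2 + M), (N - c) / N) < 1, where I = int beta.
    Existence, uniqueness and convergence all follow from this contraction. *)

Set Implicit Arguments. Unset Strict Implicit.

(** The product [(int w) w''] has no monotonicity by itself; the iteration restores it by adding
    [b int beta] to [a] and [b max |beta''|] to [c]. The right-hand side becomes [p / EI - b y''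
    (int beta - int y) + b max |beta''| int y]. On the sector each term is nonnegative, the
    coefficient of [y''] is nonpositive and that of [int y], namely [b (max |beta''| + y'')], is
    nonnegative. Hence the maximum principle gives both invariance and comparison. The kernel
    represents [- w''] and not [w], so one sign condition controls both functions: [w >= 0] then
    follows from concavity. Distances are weighted by [beta] because the operator maps [d beta] to a
    sine plus a constant, and a difference of two right-hand sides is bounded by exactly these two
    kinds of terms. *)

Local Notation integ L f := (lebesgue_measure.-integrable `[0, L] (EFin \o f)).

Definition cwi {R : realType} (L : R) (f : R -> R) := {within `[0, L], continuous f}.

Definition prim {R : realType} (L : R) (F f : R -> R) :=
  forall x, 0 <= x <= L -> F x = F 0 + int0 x f.

(* A definition rather than the class [is_derive], so that applying the rules below
   does not start an instance search for the derivative. *)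
Definition der {R : realType} (f : R -> R) (x a : R) : Prop := is_derive x 1 f a.

(** * Continuity, derivatives and primitives on [[0, L]] *)

Section primitives.
Context {R : realType}.
Implicit Types (L x : R) (f g F : R -> R).

Lemma cwi_cst L (c : R) : cwi L (fun=> c).
Proof. move=> x; exact: cvg_cst. Qed.

Lemma cwiD L f g : cwi L f -> cwi L g -> cwi L (fun x => f x + g x).
Proof. by move=> cf cg x; apply: cvgD; [exact: cf|exact: cg]. Qed.

Lemma cwiN L f : cwi L f -> cwi L (fun x => - f x).
Proof. by move=> cf x; apply: cvgN; exact: cf. Qed.

Lemma cwiM L f g : cwi L f -> cwi L g -> cwi L (fun x => f x * g x).
Proof. by move=> cf cg x; apply: cvgM; [exact: cf|exact: cg]. Qed.

Lemma cwi_continuous L f : continuous f -> cwi L f.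
Proof. exact: continuous_subspaceT. Qed.

Lemma cwi_is_derive L f (f' : R -> R) : (forall x, der f x (f' x)) -> cwi L f.
Proof.
move=> df; apply: cwi_continuous => x.
by apply/differentiable_continuous/derivable1_diffP; case: (df x).
Qed.

Lemma cwi_integrable L f : cwi L f ->
  lebesgue_measure.-integrable `[0, L] (EFin \o f).
Proof.
by move=> cf; apply: continuous_compact_integrable => //; exact: segment_compact.
Qed.

Lemma cwi_ext L f g : (forall x, 0 <= x <= L -> f x = g x) -> cwi L f -> cwi L g.
Proof.
move=> fg; apply: subspace_eq_continuous => x.
by rewrite inE/= in_itv/= => /fg.
Qed.

Lemma cwi_interior L f x : 0 < x < L -> cwi L f -> {for x, continuous f}.
Proof.
move=> xL; move: (xL) => /andP[x0 xL'] cf.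
have sub : `]0, L[ `<=` `[0, L].
  by move=> y /=; rewrite !in_itv/= => /andP[/ltW -> /ltW ->].
have := continuous_subspaceW sub cf.
rewrite continuous_open_subspace; last exact: interval_open.
by apply; rewrite inE/= in_itv.
Qed.

Lemma prim_cwi L F f : 0 <= L -> lebesgue_measure.-integrable `[0, L] (EFin \o f) ->
  prim L F f -> cwi L F.
Proof.
move=> L0 fi pF; apply: (@cwi_ext _ (fun x => F 0 + int0 x f)).
  by move=> x /pF.
by apply: cwiD; [exact: cwi_cst|exact: parameterized_integral_continuous].
Qed.

(** Only at interior points: nothing is known about [F] outside [[0, L]], so a two-sided derivative
    at an end point may fail to exist. *)
Lemma prim_is_derive L F f x : cwi L f -> prim L F f -> 0 < x < L ->
  der F x (f x).
Proof.
move=> cf pF xL; move: (xL) => /andP[x0 xL'].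
have [dI I'] := continuous_FTC1_closed xL' (cwi_integrable cf) x0 (cwi_interior xL cf).
have D : is_derive x 1 (fun x => F 0 + int0 x f) (f x).
  apply: is_derive_eq; first apply: is_deriveD.
    by apply: DeriveDef; [exact: dI|rewrite -derive1E; exact: I'].
  by rewrite add0r.
apply: near_eq_is_derive D.
near=> y; apply/esym/pF/andP; split; apply/ltW; near: y.
  exact: lt_nbhsr.
exact: lt_nbhsl.
Unshelve. all: by end_near. Qed.

Lemma MVT_on L F f (s t : R) : cwi L F ->
  (forall x, 0 < x < L -> der F x (f x)) -> 0 <= s -> s < t -> t <= L ->
  exists2 x, s < x < t & F t - F s = f x * (t - s).
Proof.
move=> cF dF s0 st tL.
have [||x] := @MVT _ F f s t st.
- move=> x; rewrite in_itv/= => /andP[sx xt].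
  by apply: dF; rewrite (le_lt_trans s0 sx) (lt_le_trans xt tL).
- apply: continuous_subspaceW cF => x /=; rewrite !in_itv/= => /andP[sx xt].
  by rewrite (le_trans s0 sx) (le_trans xt tL).
- by rewrite in_itv/= => xst E; exists x.
Qed.

Lemma int00 f : int0 0 f = 0.
Proof. by rewrite /int0 set_itv1 Rintegral_set1. Qed.

Lemma derive_prim L F f : cwi L F -> (forall x, 0 < x < L -> der F x (f x)) ->
  cwi L f -> prim L F f.
Proof.
move=> cF dF cf x /andP[]; rewrite le_eqVlt => /predU1P[<- _|x0 xL].
  by rewrite int00 addr0.
have sub : `[0, x] `<=` `[0, L].
  move=> y /=; rewrite !in_itv/= => /andP[-> /=] yx; exact: le_trans xL.
have cFx : {within `[0, x], continuous F} by exact: continuous_subspaceW cF.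
have/(continuous_within_itvP F x0)[cF1 cF2 cF3] := cFx.
rewrite /int0 /Rintegral (@continuous_FTC2 _ f F 0 x) //=; last 3 first.
- exact: continuous_subspaceW cf.
- split=> // y; rewrite in_itv/= => /andP[y0 yx].
  by case: (dF y) => //; rewrite y0 (lt_le_trans yx).
- move=> y; rewrite in_itv/= => /andP[y0 yx]; rewrite derive1E.
  by case: (dF y) => //; rewrite y0 (lt_le_trans yx).
by rewrite subrKC.
Qed.

End primitives.

(** * Rules of differentiation, hyperbolic inequalities, rules of integration *)

Section hyperbolic_and_integrals.
Context {R : realType}.
Implicit Types (L x : R) (f g F : R -> R).

Lemma der_eq f x (a b : R) : der f x a -> a = b -> der f x b.
Proof. by move=> + <-. Qed.

Lemma derD f g x (a b : R) : der f x a -> der g x b ->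
  der (fun t => f t + g t) x (a + b).
Proof. exact: is_deriveD. Qed.

Lemma derN f x (a : R) : der f x a -> der (fun t => - f t) x (- a).
Proof. exact: is_deriveN. Qed.

Lemma derM f g x (a b : R) : der f x a -> der g x b ->
  der (fun t => f t * g t) x (a * g x + f x * b).
Proof.
move=> fa gb; apply: (is_derive_eq (is_deriveM fa gb)).
by rewrite /GRing.scale/= addrC (mulrC (g x)).
Qed.

Lemma der_cst (c x : R) : der (fun=> c) x 0.
Proof. exact: is_derive_cst. Qed.

Lemma der_id x : der (fun t : R => t) x 1.
Proof. exact: is_derive_id. Qed.

Lemma der_comp f g x (a b : R) : der f (g x) a -> der g x b ->
  der (fun t => f (g t)) x (a * b).
Proof. exact: is_derive1_comp. Qed.

Lemma der_expR x : der (@expR R) x (expR x).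
Proof. exact: is_derive_expR. Qed.

Lemma der_sinh x : der (@sinhR R) x (coshR x).
Proof.
rewrite /sinhR; apply: der_eq.
  apply: derM; last exact: der_cst.
  apply: derD; first exact: der_expR.
  by apply: derN; apply: der_comp; [exact: der_expR|apply: derN; exact: der_id].
by rewrite /coshR; lra.
Qed.

Lemma der_cosh x : der (@coshR R) x (sinhR x).
Proof.
rewrite /coshR; apply: der_eq.
  apply: derM; last exact: der_cst.
  apply: derD; first exact: der_expR.
  by apply: der_comp; [exact: der_expR|apply: derN; exact: der_id].
by rewrite /sinhR; lra.
Qed.

Lemma cosh2_sinh2 (t : R) : coshR t ^+ 2 - sinhR t ^+ 2 = 1.
Proof.
rewrite /coshR /sinhR.
have := expRxMexpNx_1 t; set a := expR t; set b := expR (- t) => ab.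
by rewrite -[RHS]ab; field.
Qed.

Lemma sinhB (x y : R) : sinhR (x - y) = sinhR x * coshR y - coshR x * sinhR y.
Proof. by rewrite /sinhR /coshR opprB !expRD; field. Qed.

Lemma coshB (x y : R) : coshR (x - y) = coshR x * coshR y - sinhR x * sinhR y.
Proof. by rewrite /sinhR /coshR opprB !expRD; field. Qed.

Lemma sinh0 : @sinhR R 0 = 0. Proof. by rewrite /sinhR oppr0 subrr mul0r. Qed.
Lemma cosh0 : @coshR R 0 = 1. Proof. by rewrite /coshR oppr0 expR0; field. Qed.

Lemma cosh_ge1 (x : R) : 1 <= coshR x.
Proof.
have := expRxMexpNx_1 x; have := expR_gt0 (- x); rewrite /coshR.
set a := expR x; set b := expR (- x) => b0 ab.
have := mulr_ge0 (ltW b0) (sqr_ge0 (a - 1)).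
have -> : b * (a - 1) ^+ 2 = (a * b) * a - 2 * (a * b) + b by ring.
by rewrite ab; lra.
Qed.

Lemma cwi_sinh L : cwi L (@sinhR R).
Proof. exact: cwi_is_derive der_sinh. Qed.
Lemma cwi_cosh L : cwi L (@coshR R).
Proof. exact: cwi_is_derive der_cosh. Qed.

Lemma sinh_ge (x : R) : 0 <= x -> x <= sinhR x.
Proof.
rewrite le_eqVlt => /predU1P[<-|x0]; first by rewrite sinh0.
have [y _] := MVT_on (@cwi_sinh x) (fun y _ => der_sinh y) (lexx 0) x0 (lexx x).
by rewrite sinh0 !subr0 => ->; rewrite ler_peMl ?cosh_ge1// ltW.
Qed.

Lemma sinh_lt_mulcosh (x : R) : 0 < x -> sinhR x < x * coshR x.
Proof.
move=> x0; pose F (t : R) := t * coshR t - sinhR t.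
have dF (y : R) : der F y (y * sinhR y).
  rewrite /F; apply: der_eq.
    apply: derD; last by apply: derN; exact: der_sinh.
    by apply: derM; [exact: der_id|exact: der_cosh].
  by rewrite /=; ring.
have cF : cwi x F by exact: cwi_is_derive dF.
have [y /andP[y0 yx]] := MVT_on cF (fun y _ => dF y) (lexx 0) x0 (lexx x).
rewrite /F sinh0 mul0r !subr0 => E; rewrite -subr_gt0 E.
by apply: (mulr_gt0 (mulr_gt0 y0 _) x0); exact: lt_le_trans (sinh_ge (ltW y0)).
Qed.

(** This is [tanh (x / 2) < x / 2] without division. One differentiation reduces it to
    [sinh_lt_mulcosh], another to the positivity of [x * sinhR x]. *)
Lemma cosh_lt_mulsinh (x : R) : 0 < x -> 2 * (coshR x - 1) < x * sinhR x.
Proof.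
move=> x0; pose F (t : R) := t * sinhR t - 2 * (coshR t - 1).
have dF (y : R) : der F y (y * coshR y - sinhR y).
  rewrite /F; apply: der_eq.
    apply: derD; last first.
      apply: derN; apply: derM; first exact: der_cst.
      by apply: derD; [exact: der_cosh|apply: derN; exact: der_cst].
    by apply: derM; [exact: der_id|exact: der_sinh].
  by rewrite /=; ring.
have cF : cwi x F by exact: cwi_is_derive dF.
have [y /andP[y0 yx]] := MVT_on cF (fun y _ => dF y) (lexx 0) x0 (lexx x).
rewrite /F cosh0 subrr !mulr0 mul0r !subr0 => E; rewrite -subr_gt0 E.
by rewrite mulr_gt0// subr_gt0 sinh_lt_mulcosh.
Qed.

Lemma aeS (P Q : R -> Prop) : (forall x, P x -> Q x) ->
  {ae lebesgue_measure, forall x, P x} -> {ae lebesgue_measure, forall x, Q x}.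
Proof. by move=> PQ; apply: filterS; first exact: (ae_filter_ringOfSetsType lebesgue_measure). Qed.

Lemma aeS2 (P Q S : R -> Prop) : (forall x, P x -> Q x -> S x) ->
  {ae lebesgue_measure, forall x, P x} -> {ae lebesgue_measure, forall x, Q x} ->
  {ae lebesgue_measure, forall x, S x}.
Proof. by move=> PQ; apply: filterS2; first exact: (ae_filter_ringOfSetsType lebesgue_measure). Qed.

Lemma ae_all (P : R -> Prop) : (forall x, P x) -> {ae lebesgue_measure, forall x, P x}.
Proof. by move=> p; exact: aeW. Qed.

Lemma integS L x f : x <= L -> integ L f -> integ x f.
Proof.
move=> xL; apply: integrableS => // y /=; rewrite !in_itv/= => /andP[-> /=] yx.
exact: le_trans xL.
Qed.

Lemma integD L f g : integ L f -> integ L g -> integ L (fun x => f x + g x).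
Proof. by move=> fi gi; exact: (integrableD _ fi gi). Qed.

Lemma integZ L (k : R) f : integ L f -> integ L (fun x => k * f x).
Proof. by move=> fi; exact: (integrableZl _ k fi). Qed.

Lemma integ_cst L (k : R) : integ L (fun=> k).
Proof. by apply: cwi_integrable; exact: cwi_cst. Qed.

Lemma int0D x f g : integ x f -> integ x g ->
  int0 x (fun t => f t + g t) = int0 x f + int0 x g.
Proof. by move=> fi gi; rewrite /int0 RintegralD. Qed.

Lemma int0Z x (k : R) f : integ x f -> int0 x (fun t => k * f t) = k * int0 x f.
Proof. by move=> fi; rewrite /int0 RintegralZl. Qed.

Lemma int0_ext x f g : (forall t, 0 <= t <= x -> f t = g t) -> int0 x f = int0 x g.
Proof.
by move=> fg; apply: eq_Rintegral => t; rewrite inE/= in_itv/= => /fg.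
Qed.

Lemma int0_le x f g : integ x f -> integ x g ->
  (forall t, 0 <= t <= x -> f t <= g t) -> int0 x f <= int0 x g.
Proof.
move=> fi gi fg; apply: le_Rintegral => // t /=; rewrite in_itv/=; exact: fg.
Qed.

Lemma primD L F f G g : prim L F f -> prim L G g -> integ L f -> integ L g ->
  prim L (fun x => F x + G x) (fun x => f x + g x).
Proof.
move=> pF pG fi gi x xL; have /andP[_ xL'] := xL.
by rewrite int0D ?(integS xL')// (pF _ xL) (pG _ xL); ring.
Qed.

Lemma primZ L (k : R) F f : prim L F f -> integ L f ->
  prim L (fun x => k * F x) (fun x => k * f x).
Proof.
move=> pF fi x xL; have /andP[_ xL'] := xL.
by rewrite int0Z ?(integS xL')// (pF _ xL); ring.
Qed.

Lemma prim_nondecr L F f (s t : R) : integ L f -> prim L F f ->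
  {ae lebesgue_measure, forall x, 0 < x < L -> 0 <= f x} ->
  0 <= s -> s <= t -> t <= L -> F s <= F t.
Proof.
move=> fi pF f0 s0; rewrite le_eqVlt => /predU1P[<-//|st] tL.
have t0 := le_trans s0 (ltW st).
rewrite (pF s) ?s0 ?(le_trans (ltW st))// (pF t) ?t0// lerD2l -subr_ge0.
rewrite /int0 Rintegral_itvB ?bnd_simp//; last 2 first.
  by apply: integS fi.
  exact: ltW.
have sub : `]s, t[ `<=` `[0, L].
  move=> y /=; rewrite !in_itv/= => /andP[sy yt].
  by rewrite (le_trans s0 (ltW sy)) (le_trans (ltW yt)).
have fi' : lebesgue_measure.-integrable `]s, t[ (EFin \o f).
  by apply: integrableS fi.
rewrite -Rintegral_itv_bndo_bndc// /Rintegral.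
have mf : measurable_fun `]s, t[ f by apply/measurable_EFinP; case/integrableP: fi'.
(* As [f] is nonnegative only almost everywhere, it is replaced by its absolute value, which has the
   same integral. *)
rewrite [X in fine X](_ : _ = \int[lebesgue_measure]_(x in `]s, t[) `|f x|%:E)%E.
  by apply: fine_ge0; apply: integral_ge0.
apply: ae_eq_integral => //.
- by apply/measurable_EFinP.
- by apply/measurable_EFinP; apply: measurableT_comp.
- apply: aeS f0 => x f0 /=; rewrite in_itv/= => /andP[sx xt].
  by rewrite ger0_norm// f0// (le_lt_trans s0 sx) (lt_le_trans xt).
Qed.

End hyperbolic_and_integrals.

(** * Linearity of [W41], and monotonicity in Stieltjes form *)

Section W41_and_stieltjes.
Context {R : realType}.
Implicit Types (L x : R) (f g F H k v w : R -> R).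

Lemma W41_prim L w w1 w2 w3 w4 : W41 L w w1 w2 w3 w4 ->
  [/\ prim L w w1, prim L w1 w2, prim L w2 w3 & prim L w3 w4].
Proof. by move=> [_ P]; split=> x /P[]. Qed.

Lemma W41_intro L w w1 w2 w3 w4 : integ L w4 -> prim L w w1 -> prim L w1 w2 ->
  prim L w2 w3 -> prim L w3 w4 -> W41 L w w1 w2 w3 w4.
Proof.
by move=> i p0 p1 p2 p3; split=> // x xL; split; [exact: p0|exact: p1|exact: p2|exact: p3].
Qed.

Lemma W41_cwi L w w1 w2 w3 w4 : 0 <= L -> W41 L w w1 w2 w3 w4 ->
  [/\ cwi L w, cwi L w1, cwi L w2 & cwi L w3].
Proof.
move=> L0 W; have [p0 p1 p2 p3] := W41_prim W; case: W => i _.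
have c3 := prim_cwi L0 i p3.
have c2 := prim_cwi L0 (cwi_integrable c3) p2.
have c1 := prim_cwi L0 (cwi_integrable c2) p1.
by split=> //; exact: prim_cwi L0 (cwi_integrable c1) p0.
Qed.

Lemma W41D L w w1 w2 w3 w4 v v1 v2 v3 v4 : 0 <= L ->
  W41 L w w1 w2 w3 w4 -> W41 L v v1 v2 v3 v4 ->
  W41 L (fun x => w x + v x) (fun x => w1 x + v1 x) (fun x => w2 x + v2 x)
    (fun x => w3 x + v3 x) (fun x => w4 x + v4 x).
Proof.
move=> L0 W V; have [p0 p1 p2 p3] := W41_prim W; have [q0 q1 q2 q3] := W41_prim V.
have [c0 c1 c2 c3] := W41_cwi L0 W; have [d0 d1 d2 d3] := W41_cwi L0 V.
case: W V => [wi _] [vi _].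
by apply: W41_intro; try (apply: primD => //; exact: cwi_integrable); exact: integD || exact: primD.
Qed.

Lemma W41Z L (k : R) w w1 w2 w3 w4 : 0 <= L -> W41 L w w1 w2 w3 w4 ->
  W41 L (fun x => k * w x) (fun x => k * w1 x) (fun x => k * w2 x)
    (fun x => k * w3 x) (fun x => k * w4 x).
Proof.
move=> L0 W; have [p0 p1 p2 p3] := W41_prim W.
have [c0 c1 c2 c3] := W41_cwi L0 W; case: W => [wi _].
by apply: W41_intro; try (apply: primZ => //; exact: cwi_integrable); exact: integZ || exact: primZ.
Qed.

(* [k H + g] is a primitive of [k dH]: on a step of length [h] it decreases by at most
   [C h] times the increment of [H], and the sum over a uniform partition tends to 0. *)
Lemma stieltjes_ndecr L k k1 H g (C s t : R) : cwi L k -> cwi L g ->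
  (forall x, 0 < x < L -> der k x (k1 x)) ->
  (forall x, 0 < x < L -> der g x (- (k1 x * H x))) ->
  (forall x y, 0 <= x -> x <= y -> y <= L -> H x <= H y) ->
  (forall x, 0 <= x <= L -> `|k1 x| <= C) ->
  0 <= s -> s <= t -> t <= L -> (forall x, s <= x <= t -> 0 <= k x) ->
  k s * H s + g s <= k t * H t + g t.
Proof.
move=> ck cg dk dg Hnd kC s0 st tL k0.
have C0 : 0 <= C by apply: le_trans (kC s _); rewrite ?normr_ge0// s0 (le_trans st).
pose f x := k x * H x + g x.
have step x y : s <= x -> x <= y -> y <= t ->
    - (C * (y - x) * (H y - H x)) <= f y - f x.
  move=> sx; rewrite le_eqVlt => /predU1P[<-|xy] yt; first by rewrite !subrr mulr0 oppr0.
  have x0 := le_trans s0 sx; have yL := le_trans yt tL.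
  (* [H] is frozen at the right end of the step: [q] is then differentiable with derivative
     [k1 z * (H y - H z)], and the rest of the increment of [f] is [k x * (H y - H x) >= 0]. *)
  pose q z := g z + k z * H y.
  have cq : cwi L q by apply: cwiD => //; apply: cwiM => //; exact: cwi_cst.
  have dq z : 0 < z < L -> der q z (k1 z * (H y - H z)).
    move=> zL; apply: der_eq.
      by apply: derD; [exact: dg|apply: derM; [exact: dk|exact: der_cst]].
    by rewrite /=; ring.
  have [z /andP[xz zy] E] := MVT_on cq dq x0 xy yL.
  have HxH : H x <= H z by apply: Hnd => //; [exact: ltW|exact: le_trans (ltW zy) yL].
  have HzH : H z <= H y by apply: Hnd => //; [exact: le_trans (ltW xz)|exact: ltW].
  have -> : f y - f x = k x * (H y - H x) + (q y - q x) by rewrite /f /q; ring.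
  have kx : 0 <= k x by apply: k0; rewrite sx (le_trans (ltW xy)).
  rewrite E.
  have zL : 0 <= z <= L by rewrite (le_trans x0 (ltW xz)) (le_trans (ltW zy)).
  have /ler_normlP[k1a k1b] := kC _ zL.
  have Hd : 0 <= H y - H x by rewrite subr_ge0 (le_trans HxH).
  have kd : 0 <= k x * (H y - H x) by exact: mulr_ge0.
  have yx : 0 <= y - x by rewrite subr_ge0 ltW.
  have P : - (C * (H y - H x)) <= k1 z * (H y - H z).
    apply: (@le_trans _ _ (- (C * (H y - H z)))).
      by rewrite lerN2 ler_wpM2l// lerD2l lerN2.
    by rewrite -mulNr ler_wpM2r ?subr_ge0// lerNl.
  have := ler_wpM2r yx P; lra.
(* With [n] steps of length [(t - s) / n] the increments of [H] telescope, so the total loss is at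
   most [K / n]. *)
pose K := C * (t - s) * (H t - H s).
have K0 : 0 <= K by rewrite !mulr_ge0// subr_ge0// Hnd.
have part (n : nat) : (0 < n)%N -> - (K / n%:R) <= f t - f s.
  move=> n0; have n0R : 0 < n%:R :> R by rewrite ltr0n.
  pose d := (t - s) / n%:R.
  have d0 : 0 <= d by rewrite divr_ge0// ?subr_ge0// ltW.
  have dn : n%:R * d = t - s by rewrite /d mulrC divfK// gt_eqF.
  have ind (i : nat) : (i <= n)%N ->
      - (C * d * (H (s + i%:R * d) - H s)) <= f (s + i%:R * d) - f s.
    elim: i => [|i IH] ilen; first by rewrite mul0r addr0 !subrr mulr0 oppr0.
    have bd (j : nat) : (j <= n)%N -> s + j%:R * d <= t.
      by move=> jn; rewrite -lerBrDl -dn ler_wpM2r// ler_nat.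
    have := step (s + i%:R * d) (s + i.+1%:R * d).
    have -> : s + i.+1%:R * d - (s + i%:R * d) = d by rewrite -natr1; ring.
    have Pi : s <= s + i%:R * d by rewrite lerDl mulr_ge0.
    have Pii : s + i%:R * d <= s + i.+1%:R * d by rewrite lerD2l ler_wpM2r// ler_nat.
    move=> /(_ Pi Pii (bd _ ilen)); have := IH (ltnW ilen); lra.
  have := ind n (leqnn n); rewrite dn subrKC.
  have -> : C * d * (H t - H s) = K / n%:R by rewrite /K /d; ring.
  by [].
(* A loss [f s - f t > 0] is refuted by taking more than [K / (f s - f t)] steps. *)
rewrite -subr_ge0 -/(f t) -/(f s) leNgt; apply/negP => neg.
have := part (Num.bound (K / (f s - f t))).+1 isT; apply/negP; rewrite -ltNge.
have e0 : 0 < f s - f t by lra.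
have /archi_boundP : 0 <= K / (f s - f t) by rewrite divr_ge0// ltW.
set n := Num.bound _ => nb.
have n1 : K / (f s - f t) < n.+1%:R by rewrite (lt_trans nb)// ltr_nat.
rewrite ltrNr opprB ltr_pdivrMr ?ltr0n// mulrC.
by move: n1; rewrite ltr_pdivrMr.
Qed.

End W41_and_stieltjes.

(* [tanh2 t = tanh (t / 2)], with the junk value [0] at [t = 0]. *)
Definition tanh2 {R : realType} (t : R) : R := (coshR t - 1) / sinhR t.
(* With Dirichlet conditions at [0] and [L], [psi] solves [- y'' = 1], [green1] solves
   [- y'' + m^2 y = 1], and [beam1] solves [- y'' + m^2 y = psi]; [beam1] is thus also the
   hinged solution of [y'''' - m^2 y'' = 1]. *)
Definition psi {R : realType} (L x : R) : R := x * (L - x) / 2.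
Definition green1 {R : realType} (m L x : R) : R :=
  (1 - coshR (m * x) + tanh2 (m * L) * sinhR (m * x)) / m ^+ 2.
Definition green1' {R : realType} (m L x : R) : R :=
  (tanh2 (m * L) * coshR (m * x) - sinhR (m * x)) / m.
Definition beam1 {R : realType} (m L x : R) : R := (psi L x - green1 m L x) / m ^+ 2.
Definition beam1' {R : realType} (m L x : R) : R := (L / 2 - x - green1' m L x) / m ^+ 2.
(* The integral of [beam1] over [0, L] and its slope at [0]. *)
Definition beam1_int {R : realType} (m L : R) : R :=
  (L ^+ 3 / 12 - (L - 2 * tanh2 (m * L) / m) / m ^+ 2) / m ^+ 2.
Definition beam1_slope {R : realType} (m L : R) : R := (L / 2 - tanh2 (m * L) / m) / m ^+ 2.

Lemma cwi_id {R : realType} (L : R) : cwi L (fun x => x).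
Proof. by apply: cwi_continuous => x; exact: cvg_id. Qed.

Ltac cw := lazymatch goal with
  | |- cwi _ (fun _ => ?c) => exact: cwi_cst
  | |- cwi _ (fun x => x) => exact: cwi_id
  | |- cwi ?L (fun x => @?f x + @?g x) => apply (@cwiD _ L f g); [cw|cw]
  | |- cwi ?L (fun x => @?f x * @?g x) => apply (@cwiM _ L f g); [cw|cw]
  | |- cwi ?L (fun x => - @?f x) => apply (@cwiN _ L f); cw
  | _ => try assumption
  end.
Ltac dr := repeat first [eassumption | exact: der_cst | exact: der_id | apply: derD | apply: derN | apply: derM].

(** * Explicit Green potentials, their symmetry and their majorants *)

Section green_functions.
Context {R : realType}.
Implicit Types (L x : R) (f g F H k v w : R -> R).

Lemma cwi_bounded L f : 0 <= L -> cwi L f ->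
  exists C, forall x, 0 <= x <= L -> `|f x| <= C.
Proof.
move=> L0 cf.
have cn : {within `[0, L], continuous (fun x => `|f x|)}.
  by move=> x; apply: cvg_norm; exact: cf.
have [c _ Hc] := EVT_max L0 cn.
by exists `|f c| => x xL; apply: Hc; rewrite in_itv.
Qed.

Section fixed.
Variables (m L : R).
Hypotheses (m0 : 0 < m) (L0 : 0 < L).
Local Notation T := (tanh2 (m * L)).
Let t0 : 0 < m * L. Proof. exact: mulr_gt0. Qed.
Let m1 : m != 0. Proof. by rewrite gt_eqF. Qed.

Lemma sinh_gt0 (x : R) : 0 < x -> 0 < sinhR x.
Proof. by move=> x0; rewrite (lt_le_trans x0)// sinh_ge// ltW. Qed.

Lemma sinh_ge0 (x : R) : 0 <= x -> 0 <= sinhR x.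
Proof. by move=> x0; rewrite (le_trans x0)// sinh_ge. Qed.

Lemma tanh2E1 : T * sinhR (m * L) = coshR (m * L) - 1.
Proof. by rewrite /tanh2 divfK// gt_eqF// sinh_gt0. Qed.

Lemma tanh2E2 : T * (coshR (m * L) + 1) = sinhR (m * L).
Proof.
have s0 := sinh_gt0 t0.
apply: (mulfI (lt0r_neq0 s0)); rewrite mulrA (mulrC (sinhR _)) tanh2E1.
by have := cosh2_sinh2 (m * L); nra.
Qed.

Lemma tanh2_ge0 : 0 <= T.
Proof. by rewrite divr_ge0 ?subr_ge0 ?cosh_ge1// ltW// sinh_gt0. Qed.

Lemma beam1_slope_gt0 : 0 < beam1_slope m L.
Proof.
rewrite /beam1_slope divr_gt0 ?exprn_gt0// subr_gt0 ltr_pdivrMr//.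
rewrite /tanh2 ltr_pdivrMr ?sinh_gt0//.
by have := cosh_lt_mulsinh t0; lra.
Qed.

Lemma der_coshm x : der (fun x => coshR (m * x)) x (m * sinhR (m * x)).
Proof.
apply: der_eq.
  by apply: der_comp; [exact: der_cosh|dr].
by rewrite /=; ring.
Qed.

Lemma der_sinhm x : der (fun x => sinhR (m * x)) x (m * coshR (m * x)).
Proof.
apply: der_eq.
  by apply: der_comp; [exact: der_sinh|dr].
by rewrite /=; ring.
Qed.

Lemma der_green1 x : der (green1 m L) x (green1' m L x).
Proof.
have dc := der_coshm x; have ds := der_sinhm x.
apply: der_eq; first by rewrite /green1; dr.
by rewrite /green1' /=; field.
Qed.

Lemma der_green1' x : der (green1' m L) x (m ^+ 2 * green1 m L x - 1).
Proof.
have dc := der_coshm x; have ds := der_sinhm x.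
apply: der_eq; first by rewrite /green1'; dr.
by rewrite /green1 /=; field.
Qed.

Lemma der_psi x : der (psi L) x (L / 2 - x).
Proof. by apply: der_eq; [rewrite /psi; dr|rewrite /=; field]. Qed.

Lemma der_beam1 x : der (beam1 m L) x (beam1' m L x).
Proof.
have dc := der_green1 x; have ds := der_psi x.
by apply: der_eq; [rewrite /beam1; dr|rewrite /beam1' /=; field].
Qed.

Lemma der_beam1' x : der (beam1' m L) x (- green1 m L x).
Proof.
have dc := der_green1' x.
by apply: der_eq; [rewrite /beam1'; dr|rewrite /=; field].
Qed.

(** Each half of the kernel needs one majorant adapted to the end [0] and one adapted to [L];
    reflection supplies the latter. *)
Lemma green1_sym x : green1 m L (L - x) = green1 m L x.
Proof.
rewrite /green1 mulrBr coshB sinhB; congr (_ / _).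
have := tanh2E1; have := tanh2E2.
set c := coshR (m * L); set s := sinhR (m * L); set c' := coshR _; set s' := sinhR _.
set T0 := tanh2 _ => E2 E1.
transitivity (1 - c * c' + s * s' + (T0 * s) * c' - (T0 * (c + 1)) * s' + T0 * s').
  by ring.
by rewrite E1 E2; ring.
Qed.

Lemma beam1_sym x : beam1 m L (L - x) = beam1 m L x.
Proof. by rewrite /beam1 green1_sym /psi; congr (_ / _); ring. Qed.

Lemma green1_le x : green1 m L x <= T * sinhR (m * x) / m ^+ 2.
Proof.
rewrite /green1 ler_pM2r ?invr_gt0 ?exprn_gt0//.
by have := cosh_ge1 (m * x); lra.
Qed.

(** The majorant has the same slope at [0] as [beam1], so the bound is sharp there, as is
    [green1_le]. This is why the corner of the kernel decides its sign everywhere. *)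
Lemma beam1_le x : 0 <= x <= L -> beam1 m L x <= beam1_slope m L / m * sinhR (m * x).
Proof.
move=> /andP[x0 xL].
have mx0 : 0 <= m * x by rewrite mulr_ge0// ltW.
have Hs := sinh_ge mx0.
have Hc : 2 * (coshR (m * x) - 1) <= m * x * sinhR (m * x).
  move: mx0; rewrite le_eqVlt => /predU1P[<-|h]; first by rewrite cosh0 sinh0 subrr !mulr0.
  exact/ltW/cosh_lt_mulsinh.
rewrite -subr_ge0.
(* Both summands are nonnegative, the first by [sinh_ge] and [x <= L], the second by
   [cosh_lt_mulsinh]. *)
have -> : beam1_slope m L / m * sinhR (m * x) - beam1 m L x =
   ((L * m - m * x) / 2 * (sinhR (m * x) - m * x)
    + (m * x * sinhR (m * x) - 2 * (coshR (m * x) - 1)) / 2) / m ^+ 4.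
  by rewrite /beam1_slope /beam1 /green1 /psi; field.
rewrite divr_ge0 ?exprn_ge0 ?(ltW m0)// addr_ge0//.
  rewrite mulr_ge0 ?subr_ge0// divr_ge0// subr_ge0 mulrC.
  by rewrite ler_wpM2r// ltW.
by rewrite divr_ge0// subr_ge0.
Qed.

End fixed.
End green_functions.

(** * Testing the equation with a kernel, and the sign condition on that kernel *)

Section green_condition.
Context {R : realType}.
Implicit Types (L x : R) (f g F H k v w : R -> R).

Lemma prim_int0 L f : prim L (fun x => int0 x f) f.
Proof. by move=> x _; rewrite int00 add0r. Qed.

(* The a.e. derivative of [greenform] is [k (w4 - m^2 w2 + N int w)] when
   [k'' = m^2 k + B psi]. *)
Definition greenform (m L N B : R) (w w1 w2 w3 k k1 : R -> R) (x : R) : R :=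
  k x * w3 x - k1 x * w2 x
  + B * (psi L x * w1 x - (L / 2 - x) * w x - int0 x w)
  + N * int0 L w * (k1 x - B * (L * (x * x) / 4 - x * x * x / 6)) / m ^+ 2.

(** [w3] is differentiable only almost everywhere, so [greenform] is split as [k * H + g]: [H]
    contains [w3] and is nondecreasing because its a.e. derivative is the nonnegative load, while
    [g] has the genuine derivative [- k1 * H] inside the interval. This is the setting of
    [stieltjes_ndecr]. *)
Lemma test_nondecr (L m N B : R) w w1 w2 w3 w4 k k1 (s t : R) :
  0 < L -> 0 < m -> W41 L w w1 w2 w3 w4 ->
  {ae lebesgue_measure, forall x, 0 < x < L ->
     0 <= w4 x - m ^+ 2 * w2 x + N * int0 L w} ->
  (forall x, der k x (k1 x)) -> (forall x, der k1 x (m ^+ 2 * k x + B * psi L x)) ->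
  0 <= s -> s <= t -> t <= L -> (forall x, s <= x <= t -> 0 <= k x) ->
  greenform m L N B w w1 w2 w3 k k1 s <= greenform m L N B w w1 w2 w3 k k1 t.
Proof.
move=> L0 m0 W ae dk dk1 s0 st tL k0.
set P := greenform m L N B w w1 w2 w3 k k1.
have L0' := ltW L0.
have [p0 p1 p2 p3] := W41_prim W; have [c0 c1 c2 c3] := W41_cwi L0' W.
have [wi _] := W.
set I := int0 L w in ae.
pose H x := w3 x + - m ^+ 2 * w1 x + N * I * x.
pose g x := P x - k x * H x.
have PE x : P x = k x * H x + g x by rewrite /g; ring.
rewrite !PE.
have ck : cwi L k by exact: cwi_is_derive dk.
have ck1 : cwi L k1 by exact: cwi_is_derive dk1.
have cpsi : cwi L (psi L) by exact: cwi_is_derive (der_psi L).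
have pI := @prim_int0 L w.
have cI : cwi L (fun x => int0 x w).
  by apply: (prim_cwi L0' _ pI); exact: cwi_integrable.
have [C kC] := cwi_bounded L0' ck1.
have gE : g = fun x => k x * (m ^+ 2 * w1 x - N * I * x) - k1 x * w2 x
    + B * (psi L x * w1 x - (L / 2 - x) * w x - int0 x w)
    + N * I * (k1 x - B * (L * (x * x) / 4 - x * x * x / 6)) / m ^+ 2.
  by apply/funext => x; rewrite /g /P /greenform /H -/I; ring.
apply: (@stieltjes_ndecr _ L k k1 H g C) => //.
- by rewrite gE; cw.
- move=> x xL.
  have d0 := prim_is_derive c1 p0 xL.
  have d1 := prim_is_derive c2 p1 xL.
  have d2 := prim_is_derive c3 p2 xL.
  have dI := prim_is_derive c0 pI xL.
  have dpsi := der_psi L x.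
  have dkx := dk x. have dk1x := dk1 x.
  rewrite gE; apply: der_eq; first by dr.
  by rewrite /H /psi /=; field; rewrite gt_eqF.
- move=> x y x0 xy yL; apply: (@prim_nondecr _ L H
    (fun x => w4 x + - m ^+ 2 * w2 x + N * I * 1)) => //.
  + apply: integD; last by apply: integZ; exact: integ_cst.
    by apply: integD => //; apply: integZ; exact: cwi_integrable.
  + apply: primD; first apply: primD => //.
    * by apply: primZ => //; exact: cwi_integrable.
    * by apply: integZ; exact: cwi_integrable.
    * apply: primZ; last exact: integ_cst.
      by apply: derive_prim; [exact: cwi_id|move=> z _; exact: der_id|exact: cwi_cst].
    * by apply: integD => //; apply: integZ; exact: cwi_integrable.
    * by apply: integZ; exact: integ_cst.
  + by apply: aeS ae => z h /h; rewrite mulr1 mulNr.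
Qed.

(** A negative value would force a negative slope before it and a positive one after it, although
    [w1] is nonincreasing. *)
Lemma concave_ge0 L w w1 w2 : 0 < L -> prim L w w1 -> prim L w1 w2 -> cwi L w -> cwi L w1 ->
  cwi L w2 -> w 0 = 0 -> w L = 0 -> (forall x, 0 <= x <= L -> w2 x <= 0) ->
  forall x, 0 <= x <= L -> 0 <= w x.
Proof.
move=> L0 p0 p1 c0 c1 c2 w0 wL neg x /andP[].
rewrite le_eqVlt => /predU1P[<-|x0]; first by rewrite w0.
rewrite le_eqVlt => /predU1P[->|xL]; first by rewrite wL.
have d0 y (h : 0 < y < L) := prim_is_derive c1 p0 h.
have d1 y (h : 0 < y < L) := prim_is_derive c2 p1 h.
have [y /andP[y0 yx] Ey] := MVT_on c0 d0 (lexx 0) x0 (ltW xL).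
have [z /andP[xz zL] Ez] := MVT_on c0 d0 (ltW x0) xL (lexx L).
have [u /andP[yu uz] Eu] := MVT_on c1 d1 (ltW y0) (lt_trans yx xz) (ltW zL).
have u2 : w2 u <= 0 by apply: neg; rewrite (ltW (lt_trans y0 yu)) (ltW (lt_trans uz zL)).
have wzy : w1 z <= w1 y.
  rewrite -subr_le0 Eu mulr_le0_ge0// subr_ge0; exact: ltW (lt_trans yx xz).
rewrite leNgt; apply/negP => wx.
rewrite w0 !subr0 in Ey; rewrite wL sub0r in Ez.
have y1 : w1 y < 0 by move: wx; rewrite Ey pmulr_llt0.
have : w1 z * (L - x) < 0 by rewrite pmulr_llt0 ?subr_gt0// (le_lt_trans wzy).
by rewrite -Ez oppr_lt0 ltNge (ltW wx).
Qed.

(* Nonnegativity of the kernel [K] at its corner [(0, L)]. *)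
Definition green_cond (m L N : R) :=
  N * (coshR (m * L) - 1) * beam1_slope m L / m ^+ 2 <= 1 + N * beam1_int m L.

Lemma sigma_green_cond (M L N : R) : 0 < M -> 0 < L -> 0 < N ->
  N <= 4 * M / L ^+ 3 * sigma (Num.sqrt M * L) -> green_cond (Num.sqrt M) L N.
Proof.
move=> M0 L0 N0; set m := Num.sqrt M.
have m0 : 0 < m by rewrite sqrtr_gt0.
have mM : M = m ^+ 2 by rewrite sqr_sqrtr// ltW.
have m1 : m != 0 by rewrite gt_eqF.
rewrite /sigma mM; set t := m * L; set D := (X in _ * (_ / X)).
have t0 : 0 < t by exact: mulr_gt0.
have [D0|D0] := leP D 0. (* impossible, as the bound on [N > 0] would be nonpositive *)
  have: 4 * m ^+ 2 / L ^+ 3 * (3 * t ^+ 3 / D) <= 0.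
    rewrite mulr_ge0_le0//; first by rewrite divr_ge0 ?mulr_ge0 ?exprn_ge0 ?(ltW m0) ?(ltW L0).
    by apply: mulr_ge0_le0; [apply: mulr_ge0 => //; exact/exprn_ge0/ltW|rewrite invr_le0].
  by move=> h /le_trans /(_ h); rewrite leNgt N0.
have -> : 4 * m ^+ 2 / L ^+ 3 * (3 * t ^+ 3 / D) = 12 * m ^+ 5 / D.
  by rewrite /t; field; rewrite !gt_eqF.
rewrite ler_pdivlMr// => ND.
rewrite /green_cond -/t -subr_ge0.
(* [sinhR t] is written as [tanh2 t * (coshR t + 1)], so that the identity is rational in [coshR t]
   and [tanh2 t] and [field] can prove it. *)
have -> : 1 + N * beam1_int m L - N * (coshR t - 1) * beam1_slope m L / m ^+ 2 =
  (12 * m ^+ 5 - N * (6 * t * coshR t + 6 * t - 12 * (tanh2 t * (coshR t + 1)) - t ^+ 3))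
   / (12 * m ^+ 5).
  by rewrite /beam1_int /beam1_slope /t; field.
rewrite tanh2E2// divr_ge0 ?subr_ge0//.
by rewrite mulr_ge0// exprn_ge0// ltW.
Qed.

(** The left-hand side of [green_cond] is positive. The quantity is the denominator in the kernel
    and in the solution formula of the nonlocal problem. *)
Lemma green_pos (m L N : R) : 0 < m -> 0 < L -> 0 < N -> green_cond m L N ->
  0 < 1 + N * beam1_int m L.
Proof.
move=> m0 L0 N0; apply: lt_le_trans; have t0 := mulr_gt0 m0 L0.
apply: divr_gt0; last exact: exprn_gt0.
apply: mulr_gt0 (beam1_slope_gt0 m0 L0); apply: mulr_gt0 => //.
have [x /andP[x0 _]] :=
  MVT_on (@cwi_cosh _ (m * L)) (fun y _ => der_cosh y) (lexx 0) t0 (lexx _).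
rewrite cosh0 subr0 => ->; exact: mulr_gt0 (sinh_gt0 x0) t0.
Qed.

End green_condition.

(** * The maximum principle *)

Section maximum_principle.
Context {R : realType}.
Implicit Types (L x : R) (f g F H k v w : R -> R).

(** On either side of the diagonal the kernel, as a function of [s], is a multiple of a hyperbolic
    sine minus a multiple of [beam1]. Since [beam1'' = m^2 beam1 - psi], it satisfies the equation
    that [test_nondecr] asks for. *)
Lemma der_kernel (m L a B : R) e e1 : 0 < m ->
  (forall x, der e x (e1 x)) -> (forall x, der e1 x (m ^+ 2 * e x)) ->
  let k x := a * e x - B * beam1 m L x in
  let k1 x := a * e1 x - B * beam1' m L x in
  (forall x, der k x (k1 x)) /\ (forall x, der k1 x (m ^+ 2 * k x + B * psi L x)).
Proof.
move=> m0 de de1 k k1; have m1 : m != 0 by rewrite gt_eqF.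
split=> x.
  have d1 := de x; have dv := der_beam1 L m0 x.
  by apply: der_eq; [rewrite /k; dr|rewrite /k1 /=; ring].
have d1 := de1 x; have dv := der_beam1' L m0 x.
apply: der_eq; first by rewrite /k1; dr.
by rewrite /k /beam1 /=; field.
Qed.

Lemma sinh_lt_cosh (x : R) : sinhR x < coshR x.
Proof. by rewrite /sinhR /coshR; have := expR_gt0 (- x); lra. Qed.

Lemma cosh_sub1_le_sinh (x : R) : 0 <= x -> coshR x - 1 <= sinhR x.
Proof.
move=> x0; have : expR (- x) <= 1 by rewrite expR_le1 oppr_le0.
by rewrite /sinhR /coshR; lra.
Qed.

(** By concavity: the second derivative is [tanh2 (m * L) * sinhR (m * x) - coshR (m * x)], which is
    negative as [tanh2 (m * L) <= 1] and [sinhR < coshR]. *)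
Lemma green1_ge0 (m L x : R) : 0 < m -> 0 < L -> 0 <= x <= L -> 0 <= green1 m L x.
Proof.
move=> m0 L0; have m1 : m != 0 by rewrite gt_eqF.
have cp : cwi L (green1 m L) by exact: cwi_is_derive (der_green1 L m0).
have cp1 : cwi L (green1' m L) by exact: cwi_is_derive (der_green1' L m0).
have cp2 : cwi L (fun x => m ^+ 2 * green1 m L x - 1) by cw.
apply: (@concave_ge0 _ L (green1 m L) (green1' m L) (fun x => m ^+ 2 * green1 m L x - 1)) => //.
- by apply: derive_prim => // y _; exact: der_green1.
- by apply: derive_prim => // y _; exact: der_green1'.
- by rewrite /green1 mulr0 cosh0 sinh0; ring.
- by rewrite /green1 tanh2E1//; ring.
move=> y /andP[y0 yL].
have -> : m ^+ 2 * green1 m L y - 1 = tanh2 (m * L) * sinhR (m * y) - coshR (m * y).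
  by rewrite /green1; field.
have T1 : tanh2 (m * L) <= 1.
  have t0 := mulr_gt0 m0 L0.
  by rewrite /tanh2 ler_pdivrMr ?sinh_gt0// mul1r cosh_sub1_le_sinh// ltW.
rewrite subr_le0; apply: le_trans (ltW (sinh_lt_cosh _)).
by rewrite ler_piMl// sinh_ge0// mulr_ge0// ltW.
Qed.

(** For fixed [x], [test_nondecr] is applied on [[0, x]] and on [[x, L]] to the two halves of the
    kernel. In the sum only the jump of the kernel's derivative at [x] survives, and it multiplies
    [- w2 x]. *)
Theorem max_principle (L m N : R) w w1 w2 w3 w4 :
  0 < L -> 0 < m -> 0 < N -> green_cond m L N ->
  W41 L w w1 w2 w3 w4 -> hinged_bc L w w2 ->
  {ae lebesgue_measure, forall x, 0 < x < L ->
     0 <= w4 x - m ^+ 2 * w2 x + N * int0 L w} ->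
  forall x, 0 <= x <= L -> w2 x <= 0 /\ 0 <= w x.
Proof.
move=> L0 m0 N0 gc W [w0 [wL [w20 w2L]]] ae.
have [p0 p1 p2 p3] := W41_prim W; have [c0 c1 c2 c3] := W41_cwi (ltW L0) W.
suff neg x : 0 <= x <= L -> w2 x <= 0.
  by move=> x xL; split; [exact: neg|exact: (concave_ge0 L0 p0 p1)].
move=> /andP[]; rewrite le_eqVlt => /predU1P[<-|x0]; first by rewrite w20.
rewrite le_eqVlt => /predU1P[->|xL]; first by rewrite w2L.
have m1 : m != 0 by rewrite gt_eqF.
have A0 := green_pos m0 L0 N0 gc.
set A := 1 + N * beam1_int m L in A0.
set s := sinhR (m * L).
have s0 : 0 < s by exact: sinh_gt0 (mulr_gt0 m0 L0).
(* [kl] and [kr] below are [A K(x, .)] to the left and to the right of [x]. With this [B] all terms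
   in [int w] cancel at the end. *)
pose B := N * green1 m L x.
pose al := A * sinhR (m * (L - x)) / (m * s).
pose ar := A * sinhR (m * x) / (m * s).
pose el y := sinhR (m * y).
pose el1 y := m * coshR (m * y).
pose er y := sinhR (m * (L - y)).
pose er1 y := - (m * coshR (m * (L - y))).
have del y : der el y (el1 y) by exact: der_sinhm.
have del1 y : der el1 y (m ^+ 2 * el y).
  have d := der_coshm m y.
  by apply: der_eq; [rewrite /el1; dr|rewrite /el /=; ring].
have der' y : der er y (er1 y).
  apply: der_eq; first by apply: (@der_comp _ el (fun y => L - y)); [exact: del|dr].
  by rewrite /el1 /er1 /=; ring.
have der1 y : der er1 y (m ^+ 2 * er y).
  apply: der_eq.
    by rewrite /er1; apply: derN; apply: (@der_comp _ el1 (fun y => L - y)); [exact: del1|dr].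
  by rewrite /el /er /=; ring.
have [dkl dkl1] := @der_kernel m L al B el el1 m0 del del1.
have [dkr dkr1] := @der_kernel m L ar B er er1 m0 der' der1.
set kl := (fun y => al * el y - _) in dkl dkl1.
set kl1 := (fun y => al * el1 y - _) in dkl dkl1.
set kr := (fun y => ar * er y - _) in dkr dkr1.
set kr1 := (fun y => ar * er1 y - _) in dkr dkr1.
have T0 := tanh2_ge0 m0 L0.
have E1 := tanh2E1 m0 L0; have E2 := tanh2E2 m0 L0; have v0 := beam1_slope_gt0 m0 L0.
rewrite -/s in E1 E2.
pose T := tanh2 (m * L); rewrite -/T in T0 E1 E2.
have mpos y : 0 <= y -> 0 <= sinhR (m * y).
  by move=> y0; apply: sinh_ge0; rewrite mulr_ge0// ltW.
(* Both halves have this shape, with [(y, z)] equal to [(L - x, s)] on the left and [(x, L - s)] on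
   the right. The majorants leave a common factor, whose coefficients are compared by
   [green_cond]. *)
have main y z : 0 <= y <= L -> 0 <= z <= L -> green1 m L x <= T * sinhR (m * y) / m ^+ 2 ->
  0 <= A * sinhR (m * y) / (m * s) * sinhR (m * z) - B * beam1 m L z.
  move=> yL zL phiy; rewrite subr_ge0 /B.
  have sy : 0 <= sinhR (m * y) by apply: mpos; case/andP: yL.
  have sz : 0 <= sinhR (m * z) by apply: mpos; case/andP: zL.
  have vz := beam1_le m0 zL.
  have phi0 : 0 <= green1 m L x by apply: green1_ge0 => //; rewrite !ltW.
  apply: (@le_trans _ _ (N * (T * sinhR (m * y) / m ^+ 2) * (beam1_slope m L / m * sinhR (m * z)))).
    apply: (@le_trans _ _ (N * green1 m L x * (beam1_slope m L / m * sinhR (m * z)))).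
      by rewrite ler_wpM2l// mulr_ge0// ltW.
    rewrite ler_wpM2r//; last by rewrite ler_wpM2l// ltW.
    by apply: mulr_ge0 sz; apply: divr_ge0; exact: ltW.
  have -> : N * (T * sinhR (m * y) / m ^+ 2) * (beam1_slope m L / m * sinhR (m * z)) =
     (N * (T * s) * beam1_slope m L / m ^+ 2) * (sinhR (m * y) * sinhR (m * z) / (m * s)).
    by field; rewrite m1 gt_eqF.
  have -> : A * sinhR (m * y) / (m * s) * sinhR (m * z) =
     A * (sinhR (m * y) * sinhR (m * z) / (m * s)) by ring.
  rewrite E1 ler_wpM2r//; apply: divr_ge0; first exact: mulr_ge0.
  by apply: mulr_ge0; exact: ltW.
have xL' : 0 <= x <= L by rewrite !ltW.
have Lx' : 0 <= L - x <= L by lra.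
have kl0 y : 0 <= y <= x -> 0 <= kl y.
  move=> /andP[y0 yx]; apply: main => //; first by rewrite y0 (le_trans yx)// ltW.
  by rewrite -green1_sym//; exact: green1_le.
have kr0 y : x <= y <= L -> 0 <= kr y.
  move=> /andP[xy yL]; rewrite /kr -beam1_sym//; apply: main => //; last exact: green1_le.
  by rewrite subr_ge0 yL lerBlDr lerDl (le_trans (ltW x0)).
have Pl : greenform m L N B w w1 w2 w3 kl kl1 0 <= greenform m L N B w w1 w2 w3 kl kl1 x :=
  test_nondecr L0 m0 W ae dkl dkl1 (lexx 0) (ltW x0) (ltW xL) kl0.
have Pr : greenform m L N B w w1 w2 w3 kr kr1 x <= greenform m L N B w w1 w2 w3 kr kr1 L :=
  test_nondecr L0 m0 W ae dkr dkr1 (ltW x0) (ltW xL) (lexx L) kr0.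
(* The kernel is continuous across the diagonal, so the terms in [w3 x] cancel. *)
have krl : kr x = kl x by rewrite /kr /kl /al /ar /er /el; ring.
have kl00 : kl 0 = 0.
  by rewrite /kl /el mulr0 sinh0 /beam1 /green1 !mulr0 cosh0 sinh0 /psi; ring.
have krL : kr L = 0.
  by rewrite /kr /er subrr mulr0 sinh0 -beam1_sym// subrr /beam1 /green1 !mulr0 cosh0 sinh0 /psi; ring.
have := lerD Pl Pr; rewrite /greenform int00 kl00 krL krl w20 w2L w0 wL.
have -> : psi L 0 = 0 by rewrite /psi mul0r mul0r.
have -> : psi L L = 0 by rewrite /psi subrr mulr0 mul0r.
set I := int0 L w.
have Ec : coshR (m * (L - x)) = coshR (m * L) * coshR (m * x) - s * sinhR (m * x).
  by rewrite mulrBr coshB.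
have Es : sinhR (m * (L - x)) = s * coshR (m * x) - coshR (m * L) * sinhR (m * x).
  by rewrite mulrBr sinhB.
have C1 := cosh2_sinh2 (m * x).
(* The unit jump of the derivative of [G], scaled by [A]; [C1] evaluates the Wronskian. *)
have jump : kl1 x - kr1 x = A.
  transitivity (A * (coshR (m * x) ^+ 2 - sinhR (m * x) ^+ 2)); last by rewrite C1 mulr1.
  rewrite /kl1 /kr1 /al /ar /el1 /er1 Ec Es; field.
  by rewrite m1 gt_eqF.
have ends : kl1 0 - kr1 L = A * (1 - m ^+ 2 * green1 m L x) - 2 * B * beam1_slope m L.
  rewrite /kl1 /kr1.
  have -> : beam1' m L L = - beam1_slope m L.
    by rewrite /beam1' /green1' -/T -/s -E2 /beam1_slope -/T; field.
  have -> : beam1' m L 0 = beam1_slope m L.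
    by rewrite /beam1' /green1' mulr0 cosh0 sinh0 /beam1_slope; field.
  rewrite /al /ar /el1 /er1 subrr mulr0 cosh0 Es /green1 -/T.
  transitivity (A * (coshR (m * x) - (coshR (m * L) - 1) / s * sinhR (m * x)) - 2 * B * beam1_slope m L).
    by field; rewrite m1 gt_eqF.
  by rewrite -E1 mulfK ?gt_eqF//; field.
move=> h.
have : 0 <= - (kl1 x - kr1 x) * w2 x - B * I
   + N * I * ((kl1 x - kr1 x) - (kl1 0 - kr1 L) - B * (L ^+ 3 / 12)) / m ^+ 2.
  rewrite -subr_ge0 in h; apply: le_trans h _; rewrite le_eqVlt; apply/orP; left; apply/eqP.
  by field.
rewrite jump ends.
have -> : - A * w2 x - B * I + N * I * (A - (A * (1 - m ^+ 2 * green1 m L x) - 2 * B * beam1_slope m L) - B * (L ^+ 3 / 12)) / m ^+ 2 = - (A * w2 x).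
  by rewrite /A /B /beam1_slope /beam1_int; field.
by rewrite oppr_ge0 pmulr_rle0.
Qed.

End maximum_principle.

(** * Solvability of the linear problem *)

Section linear_problem.
Context {R : realType}.
Implicit Types (L x : R) (f g F H k v w : R -> R).

Lemma local_exists (L m : R) h : 0 < L -> 0 < m -> integ L h ->
  exists w w1 w2 w3 w4, [/\ W41 L w w1 w2 w3 w4, hinged_bc L w w2 &
    forall x, w4 x - m ^+ 2 * w2 x = h x].
Proof.
move=> L0 m0 hi; have L0' := ltW L0; have m1 : m != 0 by rewrite gt_eqF.
(* Subtracting the double primitive [Q] of [h] leaves a problem with continuous data. *)
pose Q1 x := int0 x h; have pQ1 : prim L Q1 h := @prim_int0 _ L h.
have cQ1 : cwi L Q1 := prim_cwi L0' hi pQ1.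
pose Q x := int0 x Q1; have pQ : prim L Q Q1 := @prim_int0 _ L Q1.
have cQ : cwi L Q := prim_cwi L0' (cwi_integrable cQ1) pQ.
pose ch x := coshR (m * x); pose sh x := sinhR (m * x).
have dch x : der ch x (m * sh x) by exact: der_coshm.
have dsh x : der sh x (m * ch x) by exact: der_sinhm.
have cch : cwi L ch by exact: cwi_is_derive dch.
have csh : cwi L sh by exact: cwi_is_derive dsh.
pose C x := int0 x (fun t => ch t * Q t).
have cC' : cwi L (fun t => ch t * Q t) by cw.
have pC : prim L C (fun t => ch t * Q t) by exact: prim_int0.
have cC : cwi L C := prim_cwi L0' (cwi_integrable cC') pC.
pose S x := int0 x (fun t => sh t * Q t).
have cS' : cwi L (fun t => sh t * Q t) by cw.
have pS : prim L S (fun t => sh t * Q t) by exact: prim_int0.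
have cS : cwi L S := prim_cwi L0' (cwi_integrable cS') pS.
(* Variation of constants, [m int_0^x sinh (m (x - t)) Q(t) dt], expanded by the addition formula.
   The multiple [g] of [sh] below achieves [w2 L = 0]. *)
pose y x := m * (sh x * C x - ch x * S x).
pose g := - (y L + Q L) / sh L.
pose E x := y x + g * sh x.
pose E1 x := m ^+ 2 * (ch x * C x - sh x * S x) + g * (m * ch x).
pose w2 x := E x + Q x.
have cE : cwi L E by rewrite /E /y; cw.
have cE1 : cwi L E1 by rewrite /E1; cw.
have cw2 : cwi L w2 by rewrite /w2; cw.
have dE x : 0 < x < L -> der E x (E1 x).
  move=> xL; have d1 := dch x; have d2 := dsh x.
  have d3 := prim_is_derive cC' pC xL; have d4 := prim_is_derive cS' pS xL.
  apply: der_eq; first by rewrite /E /y; dr.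
  by rewrite /E1 /=; ring.
have dE1 x : 0 < x < L -> der E1 x (m ^+ 2 * w2 x).
  move=> xL; have d1 := dch x; have d2 := dsh x.
  have d3 := prim_is_derive cC' pC xL; have d4 := prim_is_derive cS' pS xL.
  apply: der_eq; first by rewrite /E1; dr.
  have := cosh2_sinh2 (m * x); rewrite -/(ch x) -/(sh x) => e.
  rewrite /w2 /E /y /=.
  transitivity (m ^+ 2 * (y x + g * sh x + (ch x ^+ 2 - sh x ^+ 2) * Q x)).
    by rewrite /y; ring.
  by rewrite e /y; ring.
have pE : prim L E E1 by apply: derive_prim.
have pE1 : prim L E1 (fun x => m ^+ 2 * w2 x) by apply: derive_prim => //; cw.
have p2 : prim L w2 (fun x => E1 x + Q1 x).
  by apply: primD => //; exact: cwi_integrable.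
have im : integ L (fun x => m ^+ 2 * w2 x) by apply: cwi_integrable; cw.
have p3 : prim L (fun x => E1 x + Q1 x) (fun x => m ^+ 2 * w2 x + h x).
  by apply: primD.
pose G x := int0 x w2.
have pG : prim L G w2 by exact: prim_int0.
have cG : cwi L G := prim_cwi L0' (cwi_integrable cw2) pG.
(* The initial slope for which [w L = 0]. *)
pose d := - int0 L G / L.
pose w1 x := d + G x.
pose w x := int0 x w1.
have p1 : prim L w1 w2.
  by move=> x xL; rewrite /w1 (pG _ xL) -addrA.
have p0 : prim L w w1 by exact: prim_int0.
exists w, w1, w2, (fun x => E1 x + Q1 x), (fun x => m ^+ 2 * w2 x + h x); split.
- by apply: W41_intro => //; exact: integD.
- split; first by rewrite /w int00.
  split.
    rewrite /w /w1 int0D ?(integ_cst)//; last exact: cwi_integrable.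
    have -> : int0 L (fun=> d) = d * L.
      have pd : prim L (fun x => d * x) (fun=> d).
        apply: derive_prim; [by cw| |by cw] => x _.
        by apply: der_eq; [dr|rewrite /=; ring].
      by have := pd L; rewrite lexx L0' mulr0 add0r => /(_ isT).
    by rewrite /d divfK ?gt_eqF// addNr.
  split.
    rewrite /w2 /E /y /Q /C /S !int00 /sh !mulr0 sinh0; ring.
  rewrite /w2 /E /g divfK; first by ring.
  by rewrite gt_eqF// sinh_gt0// mulr_gt0.
- by move=> x; ring.
Qed.

Lemma W41_beam1 (m L : R) : 0 < m -> 0 < L ->
  W41 L (beam1 m L) (beam1' m L) (fun x => - green1 m L x) (fun x => - green1' m L x)
    (fun x => 1 - m ^+ 2 * green1 m L x).
Proof.
move=> m0 L0.
have cp : cwi L (green1 m L) by exact: cwi_is_derive (der_green1 L m0).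
have cp1 : cwi L (green1' m L) by exact: cwi_is_derive (der_green1' L m0).
have cv : cwi L (beam1 m L) by exact: cwi_is_derive (der_beam1 L m0).
have cv1 : cwi L (beam1' m L) by exact: cwi_is_derive (der_beam1' L m0).
apply: W41_intro.
- by apply: cwi_integrable; cw.
- by apply: derive_prim => // x _; exact: der_beam1.
- by apply: derive_prim => //; [move=> x _; exact: der_beam1'|cw].
- apply: derive_prim => //; [by cw| |by cw] => x _.
  by apply: derN; exact: der_green1.
- apply: derive_prim => //; [by cw| |by cw] => x _.
  by apply: der_eq; [apply: derN; exact: der_green1'|ring].
Qed.

Lemma int_beam1 (m L : R) : 0 < m -> 0 < L -> int0 L (beam1 m L) = beam1_int m L.
Proof.
move=> m0 L0; have m1 : m != 0 by rewrite gt_eqF.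
(* An antiderivative of [beam1]: as [green1'' = m^2 green1 - 1], the function [(green1' + x) / m^2]
   is one of [green1]. *)
pose F x := (L * (x * x) / 4 - x * x * x / 6 - (green1' m L x + x) / m ^+ 2) / m ^+ 2.
have dF x : der F x (beam1 m L x).
  have d := der_green1' L m0 x.
  by apply: der_eq; [rewrite /F; dr|rewrite /beam1 /psi /=; field].
have cv : cwi L (beam1 m L) by exact: cwi_is_derive (der_beam1 L m0).
have cF : cwi L F by exact: cwi_is_derive dF.
have := derive_prim cF (fun x _ => dF x) cv.
move=> /(_ L); rewrite lexx (ltW L0) => /(_ isT) e.
have -> : int0 L (beam1 m L) = F L - F 0 by rewrite e; ring.
rewrite /F /beam1_int /green1' !mulr0 cosh0 sinh0 -(tanh2E2 m0 L0).
by field.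
Qed.

Lemma nonlocal_exists (L m N : R) h : 0 < L -> 0 < m -> 0 < 1 + N * beam1_int m L -> integ L h ->
  exists w w1 w2 w3 w4, [/\ W41 L w w1 w2 w3 w4, hinged_bc L w w2 &
    forall x, w4 x - m ^+ 2 * w2 x + N * int0 L w = h x].
Proof.
move=> L0 m0 A0 hi.
have [w [w1 [w2 [w3 [w4 [W [b0 [bL [b20 b2L]]] e]]]]]] := local_exists L0 m0 hi.
(* Subtracting [N * I] times [beam1] produces the nonlocal term, provided that [I] is the integral
   of the corrected function; this equation determines [I]. *)
pose I := int0 L w / (1 + N * beam1_int m L).
have V := W41_beam1 m0 L0.
have X := W41D (ltW L0) W (W41Z (- (N * I)) (ltW L0) V).
eexists _, _, _, _, _; split; first exact: X.
  have v0 : beam1 m L 0 = 0 by rewrite /beam1 /green1 /psi !mulr0 cosh0 sinh0; ring.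
  have p0 : green1 m L 0 = 0 by rewrite /green1 !mulr0 cosh0 sinh0; ring.
  rewrite /hinged_bc v0 p0 b0 bL b20 b2L.
  have -> : beam1 m L L = 0 by rewrite -beam1_sym// subrr.
  have -> : green1 m L L = 0 by rewrite -green1_sym// subrr.
  by rewrite oppr0 !mulr0 addr0.
move=> x.
have [c0 _ _ _] := W41_cwi (ltW L0) W; have [d0 _ _ _] := W41_cwi (ltW L0) V.
rewrite int0D ?int0Z ?int_beam1//; [| by apply: cwi_integrable.. |by apply: integZ; apply: cwi_integrable].
rewrite -e.
have -> : int0 L w + - (N * I) * beam1_int m L = I.
  rewrite /I; field; by rewrite gt_eqF.
ring.
Qed.

End linear_problem.

(** * The sector, and the arch as a comparison function *)

Definition arch {R : realType} (lam L x : R) : R := lam * sin (pi / L * x).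

(** The second bound concerns interior points only: there a function determines its second
    derivative by [W41_unique2], and loads are compared only there. *)
Definition sector {R : realType} (lam L : R) (y y2 : R -> R) : Prop :=
  (forall x, 0 <= x <= L -> 0 <= y x <= arch lam L x) /\
  (forall x, 0 < x < L -> - (pi / L) ^+ 2 * arch lam L x <= y2 x <= 0).

(* The right-hand side of the iteration. *)
Definition load {R : realType} (b EI L lam : R) (p y y2 : R -> R) (x : R) : R :=
  p x / EI + b * y2 x * int0 L y - 2 * b * lam * (L / pi) * y2 x
  + b * lam * (pi ^+ 2 / L ^+ 2) * int0 L y.

Definition solves {R : realType} (M N L : R) (h w w2 : R -> R) : Prop :=
  exists w1 w3 w4, [/\ W41 L w w1 w2 w3 w4, hinged_bc L w w2 &
    {ae lebesgue_measure, forall x, 0 < x < L -> w4 x - M * w2 x + N * int0 L w = h x}].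

(* [field] would unfold [pi]. *)
Ltac genpi := match goal with |- context [@pi ?K] =>
  let P := fresh "P" in let P0 := fresh "P0" in
  move: (pi_gt0 K); move: (@pi K) => P P0 end.

Section arch_and_contraction.
Context {R : realType}.
Implicit Types (x : R) (f g F H k v w y : R -> R).

Lemma solves_compare (M N L : R) h1 h2 u u2 v v2 : 0 < L -> 0 < M -> 0 < N ->
  green_cond (Num.sqrt M) L N -> solves M N L h1 u u2 -> solves M N L h2 v v2 ->
  {ae lebesgue_measure, forall x, 0 < x < L -> h1 x <= h2 x} ->
  forall x, 0 <= x <= L -> v2 x <= u2 x /\ u x <= v x.
Proof.
move=> L0 M0 N0 gc [u1 [u3 [u4 [U [a0 [aL [a20 a2L]]] eu]]]]
  [v1 [v3 [v4 [V [b0 [bL [b20 b2L]]] ev]]]] h12 x xL.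
have L0' := ltW L0.
have m0 : 0 < Num.sqrt M by rewrite sqrtr_gt0.
have mM : Num.sqrt M ^+ 2 = M by rewrite sqr_sqrtr// ltW.
have X := W41D L0' V (W41Z (-1) L0' U).
have [] := max_principle L0 m0 N0 gc X _ _ xL.
- by rewrite /hinged_bc a0 aL a20 a2L b0 bL b20 b2L mulr0 addr0.
- rewrite mM.
  have [cu _ _ _] := W41_cwi L0' U; have [cv _ _ _] := W41_cwi L0' V.
  rewrite int0D ?int0Z; [|exact: cwi_integrable|exact: cwi_integrable|by apply: integZ; exact: cwi_integrable].
  have := aeS2 (fun x E1 E2 => conj E1 E2) eu (aeS2 (fun x E1 E2 => conj E1 E2) ev h12).
  by apply: aeS => z [E1 [E2 E3]] zL; move: (E1 zL) (E2 zL) (E3 zL); lra.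
- by lra.
Qed.

Lemma int0_cst x (c : R) : 0 <= x -> int0 x (fun=> c) = c * x.
Proof.
move=> x0; have pd : prim x (fun t => c * t) (fun=> c).
  apply: derive_prim; [by cw| |by cw] => z _.
  by apply: der_eq; [dr|rewrite /=; ring].
by have := pd x; rewrite lexx x0 mulr0 add0r => /(_ isT).
Qed.

Lemma W41_0 (L : R) : W41 L (fun=> 0) (fun=> 0) (fun=> 0) (fun=> 0) (fun=> 0).
Proof.
have p0 : prim L (fun=> 0 : R) (fun=> 0).
  by apply: derive_prim; [cw|move=> x _; exact: der_cst|cw].
by apply: W41_intro => //; exact: integ_cst.
Qed.

Lemma solves0 (M N L : R) : 0 < L -> solves M N L (fun=> 0) (fun=> 0) (fun=> 0).
Proof.
move=> L0; exists (fun=> 0), (fun=> 0), (fun=> 0); split=> //; first exact: W41_0.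
by apply: ae_all => x _; rewrite int0_cst ?(ltW L0)//; ring.
Qed.

Section arch_facts.
Variables (lam L : R).
Hypotheses (L0 : 0 < L) (lam0 : 0 < lam).
Let q := pi / L.
Let q0 : 0 < q. Proof. by rewrite divr_gt0// pi_gt0. Qed.
Let L0' : 0 <= L := ltW L0.

Lemma arch_bounds x : 0 <= x <= L -> 0 <= arch lam L x <= lam.
Proof.
move=> /andP[x0 xL]; rewrite /arch -/q; apply/andP; split.
  apply: mulr_ge0; first exact: ltW.
  apply: sin_ge0_pi; rewrite mulr_ge0 ?(ltW q0)//=.
  by rewrite /q mulrAC ler_pdivrMr// ler_pM2l// pi_gt0.
by rewrite -[leRHS]mulr1 ler_wpM2l ?(ltW lam0)// sin_le1.
Qed.

Lemma der_sinq x : der (fun x => sin (q * x)) x (q * cos (q * x)).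
Proof.
apply: der_eq.
  by apply: (@der_comp _ sin (fun x => q * x)); [exact: is_derive_sin|dr].
by rewrite /=; ring.
Qed.

Lemma der_cosq x : der (fun x => cos (q * x)) x (- (q * sin (q * x))).
Proof.
apply: der_eq.
  by apply: (@der_comp _ cos (fun x => q * x)); [exact: is_derive_cos|dr].
by rewrite /=; ring.
Qed.

Lemma cwi_arch : cwi L (arch lam L).
Proof.
have cs : cwi L (fun x => sin (q * x)) by exact: cwi_is_derive der_sinq.
by rewrite /arch; cw.
Qed.

Lemma int_arch : int0 L (arch lam L) = 2 * lam * L / pi.
Proof.
have cc : cwi L (fun x => cos (q * x)) by exact: cwi_is_derive der_cosq.
have pF : prim L (fun x => - (lam / q) * cos (q * x)) (arch lam L).
  apply: derive_prim; [by cw| |exact: cwi_arch] => x _.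
  have d := der_cosq x.
  apply: der_eq; first by dr.
  by rewrite /arch -/q /=; field; rewrite gt_eqF.
have := pF L; rewrite lexx L0' => /(_ isT).
have -> : q * L = pi by rewrite /q divfK// gt_eqF.
rewrite cospi mulr0 cos0 => E.
have -> : int0 L (arch lam L) = 2 * (lam / q) by move: E; lra.
by rewrite /q; genpi; field; rewrite !gt_eqF.
Qed.

Lemma W41_arch : W41 L (arch lam L) (fun x => lam * q * cos (q * x))
  (fun x => - q ^+ 2 * arch lam L x) (fun x => - (lam * q ^+ 3 * cos (q * x)))
  (fun x => q ^+ 4 * arch lam L x).
Proof.
have cc : cwi L (fun x => cos (q * x)) by exact: cwi_is_derive der_cosq.
have ca := cwi_arch.
apply: W41_intro.
- by apply: cwi_integrable; cw.
- apply: derive_prim; [by cw| |by cw] => x _; have d := der_sinq x.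
  by apply: der_eq; [rewrite /arch -/q; dr|rewrite /=; ring].
- apply: derive_prim; [by cw| |by cw] => x _; have d := der_cosq x.
  by apply: der_eq; [dr|rewrite /arch -/q /=; ring].
- apply: derive_prim; [by cw| |by cw] => x _; have d := der_sinq x.
  by apply: der_eq; [rewrite /arch -/q; dr|rewrite /=; ring].
- apply: derive_prim; [by cw| |by cw] => x _; have d := der_cosq x.
  by apply: der_eq; [dr|rewrite /arch -/q /=; ring].
Qed.

Lemma hinged_arch : hinged_bc L (arch lam L) (fun x => - q ^+ 2 * arch lam L x).
Proof.
have aL : arch lam L L = 0 by rewrite /arch divfK ?gt_eqF// sinpi mulr0.
have a0 : arch lam L 0 = 0 by rewrite /arch mulr0 sin0 mulr0.
by rewrite /hinged_bc aL a0 mulr0.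
Qed.

(** [arch] is an eigenfunction of the second derivative, so the operator is explicit on its
    multiples. With [d = 1] this bounds the sector, with smaller [d] it measures the contraction. *)
Lemma solves_arch (M N d : R) : solves M N L
  (fun x => d * ((q ^+ 2 + M) * q ^+ 2 * arch lam L x + N * (2 * lam * L / pi)))
  (fun x => d * arch lam L x) (fun x => d * (- q ^+ 2 * arch lam L x)).
Proof.
have W := W41Z d L0' W41_arch.
eexists _, _, _; split; first exact: W.
  by have [e1 [e2 _]] := hinged_arch; rewrite /hinged_bc e1 e2 !mulr0.
apply: ae_all => x _; rewrite int0Z; last by apply: cwi_integrable; exact: cwi_arch.
by rewrite int_arch; ring.
Qed.

Lemma sector_int y y2 : integ L y -> sector lam L y y2 -> 0 <= int0 L y <= 2 * lam * L / pi.
Proof.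
move=> yi [ys _]; rewrite -int_arch; apply/andP; split.
  rewrite -[leLHS](mul0r L) -(int0_cst _ L0'); apply: int0_le => //; first exact: integ_cst.
  by move=> t /ys/andP[].
apply: int0_le => //; first by apply: cwi_integrable; exact: cwi_arch.
by move=> t /ys/andP[].
Qed.

Lemma int0_dist (d : R) y z : integ L y -> integ L z ->
  (forall x, 0 <= x <= L -> `|y x - z x| <= d * arch lam L x) ->
  `|int0 L y - int0 L z| <= d * (2 * lam * L / pi).
Proof.
move=> yi zi yz; rewrite -int_arch.
have ai : integ L (arch lam L) by apply: cwi_integrable; exact: cwi_arch.
have dai := integZ d ai.
have h1 : int0 L y <= int0 L (fun x => z x + d * arch lam L x).
  apply: int0_le => //; first exact: integD.
  by move=> t /yz; rewrite ler_norml => /andP[]; lra.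
have h2 : int0 L z <= int0 L (fun x => y x + d * arch lam L x).
  apply: int0_le => //; first exact: integD.
  by move=> t /yz; rewrite ler_norml => /andP[]; lra.
rewrite int0D// int0Z// in h1; rewrite int0D// int0Z// in h2.
by rewrite ler_norml; apply/andP; split; lra.
Qed.

End arch_facts.

(** * Invariance of the sector, and contraction *)

Section contraction.
Variables (a b c EI L lam : R) (p : R -> R).
Hypotheses (L0 : 0 < L) (lam0 : 0 < lam) (a0 : 0 < a) (b0 : 0 < b) (c0 : 0 < c) (EI0 : 0 < EI).
Let M := a + 2 * b * lam * L / pi.
Let N := c + b * lam * pi ^+ 2 / L ^+ 2.
Hypothesis gc : green_cond (Num.sqrt M) L N.
Hypothesis p0 : {ae lebesgue_measure, forall x, 0 < x < L -> 0 <= p x}.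
Hypothesis pub : {ae lebesgue_measure, forall x, 0 < x < L ->
     p x / EI <= (lam * pi ^+ 4 / L ^+ 4 + a * lam * pi ^+ 2 / L ^+ 2
                  + 2 * b * lam ^+ 2 * pi / L) * sin (pi / L * x)
                 + 2 * lam * c * L / pi}.
Let q := pi / L.
Let beta := arch lam L.
Let pi0 : 0 < pi :> R := pi_gt0 R.
Let L0' : 0 <= L := ltW L0.
Let q0 : 0 < q. Proof. by rewrite divr_gt0. Qed.
Let ml := 2 * b * lam * L / pi.
Let nl := b * lam * q ^+ 2.
Let ml0 : 0 < ml. Proof. by apply: divr_gt0 => //; do 3! apply: mulr_gt0 => //. Qed.
Let nl0 : 0 < nl. Proof. by apply: mulr_gt0; [exact: mulr_gt0|exact: exprn_gt0]. Qed.
Let NE : N = c + nl. Proof. by rewrite /N /nl /q; genpi; field; rewrite gt_eqF. Qed.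
Let M0 : 0 < M. Proof. exact: addr_gt0. Qed.
Let N0 : 0 < N. Proof. by rewrite NE addr_gt0. Qed.
Let Ib := 2 * lam * L / pi.
Let mlE : ml = b * Ib. Proof. by rewrite /ml /Ib; genpi; field; rewrite gt_eqF. Qed.

(** The first quotient compares the [y2] part of a load difference with the sine part of the
    operator on [beta], the second compares the integral part with the constant part. They are below
    1 because [a > 0] and [c > 0]. *)
Definition rate : R := Num.max (ml / (q ^+ 2 + M)) (nl / N).

Lemma rate_ge0 : 0 <= rate.
Proof. by rewrite le_max divr_ge0// ?ltW// addr_gt0// exprn_gt0. Qed.

Lemma rate_lt1 : rate < 1.
Proof.
have qq : 0 < q ^+ 2 by rewrite exprn_gt0.
rewrite gt_max; apply/andP; split.
  by rewrite ltr_pdivrMr ?(addr_gt0 qq M0)// mul1r /M -/ml addrA ltrDr addr_gt0.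
by rewrite ltr_pdivrMr// mul1r NE ltrDr.
Qed.

(** In this form the signs on the sector are visible: [y2 <= 0] and [0 <= int0 L y <= Ib]. *)
Lemma loadE y y2 x : load b EI L lam p y y2 x =
  p x / EI - b * y2 x * (Ib - int0 L y) + nl * int0 L y.
Proof. by rewrite /load /Ib /nl /q; genpi; field; rewrite !gt_eqF. Qed.

Lemma sector_step y y2 w w2 : integ L y -> sector lam L y y2 ->
  solves M N L (load b EI L lam p y y2) w w2 ->
  forall x, 0 <= x <= L -> 0 <= w x <= beta x /\ - q ^+ 2 * beta x <= w2 x <= 0.
Proof.
move=> yi sy sw.
have /andP[I0 I1] := sector_int L0 yi sy; rewrite -/Ib in I1.
have [_ sy2] := sy.
have z0 := solves0 M N L0.
have s1 := solves_arch lam L0 M N 1.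
have lo := solves_compare L0 M0 N0 gc z0 sw.
have hi := solves_compare L0 M0 N0 gc sw s1.
move=> x xL.
have [|l1 l2] := lo _ x xL.
  apply: aeS p0 => z pz zL; rewrite loadE.
  have /andP[_ y20] := sy2 _ zL.
  have : 0 <= p z / EI by rewrite divr_ge0 ?pz// ltW.
  have : 0 <= - (b * y2 z) * (Ib - int0 L y).
    by rewrite mulr_ge0 ?subr_ge0// oppr_ge0 pmulr_rle0.
  have : 0 <= nl * int0 L y by rewrite mulr_ge0// ltW.
  by lra.
have [|h1 h2] := hi _ x xL.
  apply: aeS pub => z pz zL; move: (pz zL); rewrite loadE -/q.
  have zL' : 0 <= z <= L by case/andP: zL => *; rewrite !ltW.
  have /andP[y21 y20] := sy2 _ zL; rewrite -/q in y21.
  have /andP[b1 b2] := arch_bounds L0 lam0 zL'.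
  (* The bound on [p / EI] is the operator on [beta] with [c] in place of [N]; the difference
     [nl * Ib] has to absorb the other terms of the load. *)
  have -> : (lam * pi ^+ 4 / L ^+ 4 + a * lam * pi ^+ 2 / L ^+ 2 + 2 * b * lam ^+ 2 * pi / L) *
    sin (q * z) + 2 * lam * c * L / pi =
    (q ^+ 2 + M) * q ^+ 2 * arch lam L z + c * Ib.
    by rewrite /M /arch /q /Ib; move: (sin _) => S; genpi; field; rewrite !gt_eqF.
  rewrite NE -/Ib mul1r.
  (* Expanded, this says that those terms are at most [nl * Ib]. The second factor is nonnegative
     because [nl] is [b] times the maximum of [|beta''|]. *)
  have : 0 <= (Ib - int0 L y) * (nl + b * y2 z).
    apply: mulr_ge0; first by rewrite subr_ge0.
    rewrite /nl -mulrA -mulrDr pmulr_rge0//.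
    have : q ^+ 2 * arch lam L z <= q ^+ 2 * lam by rewrite ler_wpM2l// exprn_ge0// ltW.
    by lra.
  by lra.
rewrite !mul1r in h1 h2.
by rewrite l2 h2 l1 h1.
Qed.

(** [w] is compared with [v + rate * d * beta]. The estimate is one-sided, and exchanging the two
    data gives the other side. *)
Lemma solves_contraction_le (d : R) y y2 z z2 w w2 v v2 : 0 <= d -> integ L y -> integ L z ->
  sector lam L y y2 -> sector lam L z z2 ->
  (forall x, 0 <= x <= L -> `|y x - z x| <= d * beta x) ->
  (forall x, 0 < x < L -> `|y2 x - z2 x| <= d * (q ^+ 2 * beta x)) ->
  solves M N L (load b EI L lam p y y2) w w2 ->
  solves M N L (load b EI L lam p z z2) v v2 ->
  forall x, 0 <= x <= L -> w x - v x <= rate * d * beta x /\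
    v2 x - w2 x <= rate * d * (q ^+ 2 * beta x).
Proof.
move=> d0 yi zi sy sz yz yz2 sw sv x xL.
have /andP[I0 I1] := sector_int L0 yi sy; rewrite -/Ib in I1.
have /andP[J0 J1] := sector_int L0 zi sz; rewrite -/Ib in J1.
have IJ := int0_dist L0 yi zi yz; rewrite -/Ib in IJ.
have [_ sy2] := sy; have [_ sz2] := sz.
set I := int0 L y in I0 I1 IJ; set J := int0 L z in J0 J1 IJ.
have [v1 [v3 [v4 [V [bv0 [bvL [bv20 bv2L]]] ev]]]] := sv.
have [s1 [s3 [s4 [S [bs0 [bsL [bs20 bs2L]]] es]]]] := solves_arch lam L0 M N (rate * d).
have sum : solves M N L (fun x => load b EI L lam p z z2 x +
    rate * d * ((q ^+ 2 + M) * q ^+ 2 * arch lam L x + N * (2 * lam * L / pi)))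
    (fun x => v x + rate * d * arch lam L x)
    (fun x => v2 x + rate * d * (- q ^+ 2 * arch lam L x)).
  eexists _, _, _; split; first exact: W41D L0' V S.
    by rewrite /hinged_bc bv0 bvL bv20 bv2L bs0 bsL bs20 bs2L addr0.
  have [cv _ _ _] := W41_cwi L0' V; have [cs _ _ _] := W41_cwi L0' S.
  rewrite int0D; [|exact: cwi_integrable|exact: cwi_integrable].
  by apply: aeS2 ev es => t e1 e2 tL; rewrite -(e1 tL) -(e2 tL) -/q; ring.
have [|h1 h2] := solves_compare L0 M0 N0 gc sw sum _ xL.
  apply: ae_all => t tL; rewrite !loadE -/I -/J -/Ib.
  have tL' : 0 <= t <= L by case/andP: tL => *; rewrite !ltW.
  have /andP[b1 b2] := arch_bounds L0 lam0 tL'.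
  have /andP[y21 y20] := sy2 _ tL; rewrite -/q in y21.
  have /andP[z21 z20] := sz2 _ tL; rewrite -/q in z21.
  set B := arch lam L t in b1 b2 y21 z21 *.
  have yz2t : `|y2 t - z2 t| <= d * (q ^+ 2 * B) := yz2 _ tL.
  have qB : q ^+ 2 * B <= q ^+ 2 * lam by rewrite ler_wpM2l// exprn_ge0// ltW.
  have qB0 : 0 <= q ^+ 2 * B by rewrite mulr_ge0// exprn_ge0// ltW.
  (* The difference of the loads is [- b (y2 - z2) (Ib - I) + (I - J) (nl + b z2)]; [P1] and [P2]
     bound its two terms. *)
  have P1 : - b * (y2 t - z2 t) * (Ib - I) <= b * (d * (q ^+ 2 * B)) * Ib.
    apply: (@le_trans _ _ (b * (d * (q ^+ 2 * B)) * (Ib - I))).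
      rewrite ler_wpM2r ?subr_ge0// mulNr -mulrN ler_wpM2l ?(ltW b0)//.
      by move: yz2t; rewrite ler_norml => /andP[]; lra.
    rewrite ler_wpM2l//; last by lra.
    by apply: mulr_ge0; [exact: ltW|exact: mulr_ge0].
  have P2 : (I - J) * (nl + b * z2 t) <= d * Ib * nl.
    have k0 : 0 <= nl + b * z2 t.
      by rewrite /nl -mulrA -mulrDr pmulr_rge0//; lra.
    have k1 : nl + b * z2 t <= nl by rewrite gerDl pmulr_rle0.
    apply: (@le_trans _ _ (d * Ib * (nl + b * z2 t))).
      by rewrite ler_wpM2r//; move: IJ; rewrite ler_norml => /andP[].
    by rewrite ler_wpM2l// mulr_ge0// (le_trans I0).
  have Q0 : 0 < q ^+ 2 + M by rewrite addr_gt0// exprn_gt0.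
  have R1 : ml <= rate * (q ^+ 2 + M) by rewrite -ler_pdivrMr// le_max lexx.
  have R2 : nl <= rate * N by rewrite -ler_pdivrMr// le_max lexx orbT.
  have Ib0 : 0 <= Ib by rewrite (le_trans I0).
  have S1 : ml * (d * (q ^+ 2 * B)) <= rate * (q ^+ 2 + M) * (d * (q ^+ 2 * B)).
    by rewrite ler_wpM2r// mulr_ge0.
  have S2 : nl * (d * Ib) <= rate * N * (d * Ib) by rewrite ler_wpM2r// mulr_ge0.
  move: P1 P2 S1 S2; rewrite mlE; lra.
by move: h1 h2; rewrite -/beta; lra.
Qed.

Lemma solves_contraction (d : R) y y2 z z2 w w2 v v2 : 0 <= d -> integ L y -> integ L z ->
  sector lam L y y2 -> sector lam L z z2 ->
  (forall x, 0 <= x <= L -> `|y x - z x| <= d * beta x) ->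
  (forall x, 0 < x < L -> `|y2 x - z2 x| <= d * (q ^+ 2 * beta x)) ->
  solves M N L (load b EI L lam p y y2) w w2 ->
  solves M N L (load b EI L lam p z z2) v v2 ->
  forall x, 0 <= x <= L -> `|w x - v x| <= rate * d * beta x /\
    `|w2 x - v2 x| <= rate * d * (q ^+ 2 * beta x).
Proof.
move=> d0 yi zi sy sz yz yz2 sw sv x xL.
have [h1 h2] := solves_contraction_le d0 yi zi sy sz yz yz2 sw sv xL.
have zy t : 0 <= t <= L -> `|z t - y t| <= d * beta t by rewrite distrC; exact: yz.
have zy2 t : 0 < t < L -> `|z2 t - y2 t| <= d * (q ^+ 2 * beta t) by rewrite distrC; exact: yz2.
have [h3 h4] := solves_contraction_le d0 zi yi sz sy zy zy2 sv sw xL.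
by rewrite !ler_norml; split; apply/andP; split; lra.
Qed.

End contraction.
End arch_and_contraction.

(** * Geometric convergence, and the fixed point of the iteration *)

Section fixed_point.
Context {R : realType}.
Implicit Types (x : R) (f g F w : R -> R) (k : nat).

Lemma geo_small (K r e : R) : 0 <= r < 1 -> 0 < e ->
  exists n, forall k, (n <= k)%N -> K * r ^+ k < e.
Proof.
move=> /andP[r0 r1] e0.
have /cvgrPdist_lt/(_ e e0) : (geometric K r) @ \oo --> 0.
  by apply: cvg_geometric; rewrite ger0_norm.
move=> [n _ Hn]; exists n => k nk; have := Hn k nk; rewrite /= sub0r normrN.
exact: le_lt_trans (ler_norm _).
Qed.

Lemma geo_le0 (K r x : R) : 0 <= r < 1 -> (forall k, x <= K * r ^+ k) -> x <= 0.
Proof.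
move=> r01 h; rewrite leNgt; apply/negP => x0.
have [n Hn] := geo_small K r01 x0.
by have := Hn n (leqnn n); rewrite ltNge h.
Qed.

(** The intervals of centre [u k] and radius [K * r ^+ k] are nested because [K - K * r = C]. The
    supremum of their left ends lies in all of them, which yields the limit together with the
    rate. *)
Lemma geo_lim (u : nat -> R) (C r : R) : 0 <= C -> 0 <= r < 1 ->
  (forall k, `|u k.+1 - u k| <= C * r ^+ k) ->
  exists l, forall k, `|u k - l| <= C / (1 - r) * r ^+ k.
Proof.
move=> C0 /andP[r0 r1] hu.
have r1' : 0 < 1 - r by rewrite subr_gt0.
pose K := C / (1 - r).
have KC : K - K * r = C by rewrite /K; field; rewrite gt_eqF.
have step k : u k - K * r ^+ k <= u k.+1 - K * r ^+ k.+1 /\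
              u k.+1 + K * r ^+ k.+1 <= u k + K * r ^+ k.
  have := hu k; rewrite ler_norml -KC exprS => /andP[].
  by split; lra.
pose lo k := u k - K * r ^+ k; pose hi k := u k + K * r ^+ k.
have lohi k : lo k <= hi k.
  have : 0 <= K * r ^+ k by rewrite mulr_ge0 ?divr_ge0 ?exprn_ge0// ltW.
  by rewrite /lo /hi; lra.
have lomon i j : lo i <= lo (i + j)%N.
  by elim: j => [|j IH]; rewrite ?addn0// addnS (le_trans IH)//; case: (step (i + j)%N).
have himon i j : hi (i + j)%N <= hi i.
  by elim: j => [|j IH]; rewrite ?addn0// addnS (le_trans _ IH)//; case: (step (i + j)%N).
have cross i j : lo i <= hi j.
  by rewrite (le_trans (lomon i j))// (le_trans (lohi _))// addnC himon.
pose S := [set lo k | k in [set: nat]].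
have S0 : S !=set0 by exists (lo 0%N), 0%N.
exists (sup S) => k; rewrite -/K ler_norml.
have h1 : lo k <= sup S.
  by apply: sup_ubound; [exists (hi 0%N) => _ [i _ <-]|exists k].
have h2 : sup S <= hi k.
  by apply: ge_sup => // _ [i _ <-].
by move: h1 h2; rewrite /lo /hi => h1 h2; apply/andP; split; lra.
Qed.

Lemma derive_unique L F G f g x : cwi L f -> cwi L g ->
  prim L F f -> prim L G g -> (forall y, 0 < y < L -> F y = G y) -> 0 < x < L -> f x = g x.
Proof.
move=> cf cg pf pg FG xL; have /andP[x0 xL'] := xL.
have dF := prim_is_derive cf pf xL; have dG := prim_is_derive cg pg xL.
have [_ <-] : is_derive x 1 F (g x).
  apply: near_eq_is_derive dG; near=> y; apply/esym/FG/andP; split; near: y.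
    exact: lt_nbhsr.
  exact: lt_nbhsl.
by have [_ <-] := dF.
Unshelve. all: by end_near. Qed.

(** Hypotheses supply second derivatives as separate witnesses; this identifies them with those
    already under control. *)
Lemma W41_unique2 L w w1 w2 w3 w4 v1 v2 v3 v4 : 0 <= L ->
  W41 L w w1 w2 w3 w4 -> W41 L w v1 v2 v3 v4 -> forall x, 0 < x < L -> w2 x = v2 x.
Proof.
move=> L0 W V; have [p0 p1 p2 p3] := W41_prim W; have [q0 q1 q2 q3] := W41_prim V.
have [c0 c1 c2 c3] := W41_cwi L0 W; have [d0 d1 d2 d3] := W41_cwi L0 V.
move=> x; apply: (derive_unique c2 d2 p1 q1) => y.
exact: (derive_unique c1 d1 p0 q0).
Qed.

Section iter.
Variables (a b c EI L lam : R) (p : R -> R).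
Hypotheses (L0 : 0 < L) (lam0 : 0 < lam) (a0 : 0 < a) (b0 : 0 < b) (c0 : 0 < c) (EI0 : 0 < EI).
Let M := a + 2 * b * lam * L / pi.
Let N := c + b * lam * pi ^+ 2 / L ^+ 2.
Hypothesis gc : green_cond (Num.sqrt M) L N.
Hypothesis ip : integ L p.
Hypothesis p0 : {ae lebesgue_measure, forall x, 0 < x < L -> 0 <= p x}.
Hypothesis pub : {ae lebesgue_measure, forall x, 0 < x < L ->
     p x / EI <= (lam * pi ^+ 4 / L ^+ 4 + a * lam * pi ^+ 2 / L ^+ 2
                  + 2 * b * lam ^+ 2 * pi / L) * sin (pi / L * x)
                 + 2 * lam * c * L / pi}.
Let q := pi / L.
Let beta := arch lam L.
Let L0' : 0 <= L := ltW L0.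
Let pi0 : 0 < pi :> R := pi_gt0 R.
Let M0 : 0 < M.
Proof. by apply: addr_gt0 => //; apply: divr_gt0 => //; do 3! apply: mulr_gt0 => //. Qed.
Let N0 : 0 < N.
Proof.
apply: addr_gt0 => //; apply: divr_gt0; last exact: exprn_gt0.
by apply: mulr_gt0; [exact: mulr_gt0|exact: exprn_gt0].
Qed.
Let r := rate a b c L lam.
Let r01 : 0 <= r < 1.
Proof. by rewrite rate_ge0//= rate_lt1. Qed.

Let step y y2 w w2 := solves M N L (load b EI L lam p y y2) w w2.

Lemma solves_cwi h w w2 : solves M N L h w w2 -> cwi L w /\ cwi L w2.
Proof. by move=> [w1 [w3 [w4 [W _ _]]]]; have [] := W41_cwi L0' W. Qed.

Lemma solves_ext h g w w2 : (forall x, 0 < x < L -> h x = g x) ->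
  solves M N L h w w2 -> solves M N L g w w2.
Proof.
move=> hg [w1 [w3 [w4 [W B E]]]]; exists w1, w3, w4; split=> //.
by apply: aeS E => x e xL; rewrite e// hg.
Qed.

Lemma step_exists y y2 : integ L y2 -> exists w w2, step y y2 w w2.
Proof.
move=> iy2; pose I := int0 L y.
have hi : integ L (load b EI L lam p y y2).
  rewrite (_ : load b EI L lam p y y2 = fun x =>
    (EI^-1 * p x + (b * I - 2 * b * lam * (L / pi)) * y2 x)
    + b * lam * (pi ^+ 2 / L ^+ 2) * I); last first.
    by apply/funext => x; rewrite /load -/I; ring.
  by apply: integD; [apply: integD; exact: integZ|exact: integ_cst].
have m0 : 0 < Num.sqrt M by rewrite sqrtr_gt0.
have [w [w1 [w2 [w3 [w4 [W B E]]]]]] :=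
  nonlocal_exists L0 m0 (green_pos m0 L0 N0 gc) hi.
exists w, w2, w1, w3, w4; split=> //; apply: ae_all => x _.
by rewrite -E sqr_sqrtr// ltW.
Qed.

Lemma steps_exist y0 y20 : integ L y20 -> exists y y2 : nat -> R -> R,
  [/\ y 0%N = y0, y2 0%N = y20 & forall k, step (y k) (y2 k) (y k.+1) (y2 k.+1)].
Proof.
move=> i20.
have [f Hf] : {f : (R -> R) * (R -> R) -> (R -> R) * (R -> R) &
    forall s, integ L s.2 -> step s.1 s.2 (f s).1 (f s).2}.
  apply: (@choice _ _ (fun s t => integ L s.2 -> step s.1 s.2 t.1 t.2)) => s.
  (* The step has to be a total map for [choice]; on a non-integrable second component it returns
     its argument. *)
  have [i2|ni2] := pselect (integ L s.2); last by exists s.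
  by have [w [w2 sw]] := step_exists s.1 i2; exists (w, w2).
pose u k := iter k f (y0, y20).
have iu k : integ L (u k).2.
  elim: k => [//|k IH]; have [_ cu] := solves_cwi (Hf _ IH).
  exact: cwi_integrable cu.
by exists (fun k => (u k).1), (fun k => (u k).2); split=> // k; exact: Hf.
Qed.

Lemma sectorW y y2 : (forall x, 0 <= x <= L -> 0 <= y x <= beta x /\
    - q ^+ 2 * beta x <= y2 x <= 0) -> sector lam L y y2.
Proof.
move=> h; split=> x xL; first by case: (h x xL).
by case/andP: xL => /ltW x0 /ltW xL; case: (h x); rewrite ?x0.
Qed.

Lemma steps_sector (y y2 : nat -> R -> R) : integ L (y 0%N) ->
  sector lam L (y 0%N) (y2 0%N) -> (forall k, step (y k) (y2 k) (y k.+1) (y2 k.+1)) ->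
  forall k, integ L (y k) /\ sector lam L (y k) (y2 k).
Proof.
move=> i0 s0 st; elim=> [//|k [ik sk]]; split.
  by have [cy _] := solves_cwi (st k); exact: cwi_integrable.
apply: sectorW => x xL.
exact: (sector_step L0 lam0 a0 b0 c0 EI0 gc p0 pub ik sk (st k)).
Qed.

(** The sector has diameter at most 1 in the weighted distance, which starts the induction of
    [steps_dist]. *)
Lemma sector_dist y y2 z z2 : sector lam L y y2 -> sector lam L z z2 ->
  (forall x, 0 <= x <= L -> `|y x - z x| <= 1 * beta x) /\
  (forall x, 0 < x < L -> `|y2 x - z2 x| <= 1 * (q ^+ 2 * beta x)).
Proof.
move=> [y1 y2s] [z1 z2s]; split=> x xL; rewrite mul1r ler_norml.
  have /andP[? ?] := y1 x xL; have /andP[? ?] := z1 x xL.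
  by rewrite /beta; apply/andP; split; lra.
have /andP[h1 h2] := y2s x xL; have /andP[h3 h4] := z2s x xL.
by rewrite -/q -/beta in h1 h3; apply/andP; split; lra.
Qed.

Lemma steps_dist (y y2 z z2 : nat -> R -> R) :
  integ L (y 0%N) -> sector lam L (y 0%N) (y2 0%N) ->
  (forall k, step (y k) (y2 k) (y k.+1) (y2 k.+1)) ->
  integ L (z 0%N) -> sector lam L (z 0%N) (z2 0%N) ->
  (forall k, step (z k) (z2 k) (z k.+1) (z2 k.+1)) ->
  forall k, (forall x, 0 <= x <= L -> `|y k x - z k x| <= r ^+ k * beta x) /\
   (forall x, 0 < x < L -> `|y2 k x - z2 k x| <= r ^+ k * (q ^+ 2 * beta x)).
Proof.
move=> iy0 sy0 sty iz0 sz0 stz.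
have ky := steps_sector iy0 sy0 sty; have kz := steps_sector iz0 sz0 stz.
elim=> [|k [IH1 IH2]]; first by rewrite expr0; exact: sector_dist.
have [iy sy] := ky k; have [iz sz] := kz k.
have rk : 0 <= r ^+ k by rewrite exprn_ge0//; case/andP: r01.
have C := solves_contraction L0 lam0 a0 b0 c0 EI0 gc rk iy iz sy sz IH1 IH2 (sty k) (stz k).
split=> x xL; rewrite exprS; first by case: (C x xL).
by case/andP: xL => /ltW x0 /ltW xL; case: (C x); rewrite ?x0.
Qed.

(** A fixed point is a constant iteration. Applied to an iteration this gives convergence, applied
    to a second fixed point uniqueness. *)
Lemma fixed_dist u u2 (y y2 : nat -> R -> R) : integ L u -> sector lam L u u2 ->
  step u u2 u u2 -> integ L (y 0%N) -> sector lam L (y 0%N) (y2 0%N) ->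
  (forall k, step (y k) (y2 k) (y k.+1) (y2 k.+1)) ->
  forall k x, 0 <= x <= L -> `|y k x - u x| <= r ^+ k * beta x.
Proof.
move=> iu su stu iy sy sty k x xL.
have [h _] := @steps_dist y y2 (fun=> u) (fun=> u2) iy sy sty iu su (fun=> stu) k.
exact: h.
Qed.

Lemma integ_bounded f C : measurable_fun `[0, L] f ->
  (forall x, 0 <= x <= L -> `|f x| <= C) -> integ L f.
Proof.
move=> mf fC; apply: measurable_bounded_integrable => //.
  by apply: compact_finite_measure; exact: segment_compact.
exists C; split; first exact: num_real.
move=> K CK x /=; rewrite in_itv/= => xL; exact: le_trans (fC x xL) (ltW CK).
Qed.

(** A pointwise limit is measurable, and bounded by assumption. This makes the limit pair admissible
    for [step_exists]. *)
Lemma geo_integ (u : nat -> R -> R) l K C :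
  (forall k, integ L (u k)) ->
  (forall x, 0 <= x <= L -> forall k, `|u k x - l x| <= K x * r ^+ k) ->
  (forall x, 0 <= x <= L -> `|l x| <= C) -> integ L l.
Proof.
move=> iu ul lC; apply: integ_bounded lC.
apply: (@measurable_fun_cvg _ _ _ _ u) => [k|x].
  by apply/measurable_EFinP; case/integrableP: (iu k).
rewrite /= in_itv/= => xL; apply/cvgrPdist_lt => e e0.
have [n Hn] := geo_small (K x) r01 e0.
exists n => // k nk /=; rewrite distrC.
exact: le_lt_trans (ul x xL k) (Hn k nk).
Qed.

Lemma limit_between (u : nat -> R) l K A B :
  (forall k, `|u k - l| <= K * r ^+ k) -> (forall k, A <= u k <= B) -> A <= l <= B.
Proof.
move=> ul uAB; apply/andP; split; rewrite -subr_le0; apply: (geo_le0 (K := K) r01) => k;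
  have := ul k; rewrite ler_norml => /andP[h1 h2]; have /andP[h3 h4] := uAB k; lra.
Qed.

(** The limits [yl] of [y k] and [zl] of [y2 k] are only pointwise, and [zl] is not yet known to be
    a second derivative. Instead of passing to the limit in the equation, one more step is made from
    [(yl, zl)]: by contraction its result [(w, w2)] is also the limit of the iterates, so it agrees
    with [(yl, zl)] on [[0, L]] and is a fixed point. *)
Lemma fixed_exists : exists u u2, [/\ step u u2 u u2, integ L u &
  forall x, 0 <= x <= L -> 0 <= u x <= beta x /\ - q ^+ 2 * beta x <= u2 x <= 0].
Proof.
have bb x : 0 <= x <= L -> 0 <= beta x <= lam by exact: arch_bounds.
have qb x : 0 <= x <= L -> 0 <= q ^+ 2 * beta x <= q ^+ 2 * lam.
  move=> /bb/andP[h1 h2]; have q2 : 0 <= q ^+ 2 by exact: sqr_ge0.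
  by rewrite mulr_ge0//= ler_wpM2l.
have [y [y2 [e0 e20 st]]] := @steps_exist (fun=> 0) (fun=> 0) (integ_cst L 0).
have cl0 x : 0 <= x <= L -> 0 <= y 0%N x <= beta x /\ - q ^+ 2 * beta x <= y2 0%N x <= 0.
  move=> xL; rewrite e0 e20 !lexx /=; have /andP[-> _] := bb x xL.
  by rewrite mulNr oppr_le0; have /andP[-> _] := qb x xL.
have s0 := sectorW cl0.
have i0 : integ L (y 0%N) by rewrite e0; exact: integ_cst.
have ks := steps_sector i0 s0 st.
have cl k x : 0 <= x <= L -> 0 <= y k x <= beta x /\ - q ^+ 2 * beta x <= y2 k x <= 0.
  case: k => [|k]; first exact: cl0.
  have [ik sk] := ks k.
  exact: (sector_step L0 lam0 a0 b0 c0 EI0 gc p0 pub ik sk (st k)).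
have iy2 k : integ L (y2 k).
  case: k => [|k]; first by rewrite e20; exact: integ_cst.
  by have [_ cy] := solves_cwi (st k); exact: cwi_integrable.
have shift k x : 0 <= x <= L -> `|y k.+1 x - y k x| <= beta x * r ^+ k /\
    `|y2 k.+1 x - y2 k x| <= q ^+ 2 * beta x * r ^+ k.
  elim: k x => [|k IH] x xL.
    rewrite expr0 !mulr1 e0 e20 !subr0; have [/andP[h1 h2] /andP[h3 h4]] := cl 1%N x xL.
    by rewrite ger0_norm// ler0_norm// lerNl -mulNr.
  have rk : 0 <= r ^+ k by rewrite exprn_ge0//; case/andP: r01.
  have [ik1 sk1] := ks k.+1; have [ik sk] := ks k.
  have [||h1 h2] := solves_contraction L0 lam0 a0 b0 c0 EI0 gc rk ik1 ik sk1 sk _ _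
     (st k.+1) (st k) xL.
  - by move=> t /IH[]; rewrite mulrC.
  - move=> t /andP[/ltW t0 /ltW tL]; have [|_ g] := IH t; first by rewrite t0.
    by rewrite mulrC.
  by split; rewrite (exprS r) [leRHS]mulrC.
pose D := (1 - r)^-1.
have D0 : 0 <= D by rewrite invr_ge0 subr_ge0; case/andP: r01 => _ /ltW.
have [yl Hyl] : {yl : R -> R & forall x, 0 <= x <= L -> forall k,
    `|y k x - yl x| <= beta x / (1 - r) * r ^+ k}.
  apply: (@choice _ _ (fun x l => 0 <= x <= L -> forall k,
    `|y k x - l| <= beta x / (1 - r) * r ^+ k)) => x.
  have [xL|xL] := boolP (0 <= x <= L); last by exists 0.
  have /andP[b1 _] := bb x xL.
  have [|l Hl] := geo_lim (u := fun k => y k x) b1 r01; last by exists l.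
  by move=> k; case: (shift k x xL).
have [zl Hzl] : {zl : R -> R & forall x, 0 <= x <= L -> forall k,
    `|y2 k x - zl x| <= q ^+ 2 * beta x / (1 - r) * r ^+ k}.
  apply: (@choice _ _ (fun x l => 0 <= x <= L -> forall k,
    `|y2 k x - l| <= q ^+ 2 * beta x / (1 - r) * r ^+ k)) => x.
  have [xL|xL] := boolP (0 <= x <= L); last by exists 0.
  have /andP[b1 _] := qb x xL.
  have [|l Hl] := geo_lim (u := fun k => y2 k x) b1 r01; last by exists l.
  by move=> k; case: (shift k x xL).
have cll x : 0 <= x <= L -> 0 <= yl x <= beta x /\ - q ^+ 2 * beta x <= zl x <= 0.
  move=> xL; split.
    by apply: (limit_between (u := fun k => y k x) (Hyl x xL)) => k; case: (cl k x xL).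
  by apply: (limit_between (u := fun k => y2 k x) (Hzl x xL)) => k; case: (cl k x xL).
have iyl : integ L yl.
  apply: (geo_integ (u := y) (C := lam) _ Hyl) => [k|x xL]; first by case: (ks k).
  have [/andP[h1 h2] _] := cll x xL; have /andP[_ h3] := bb x xL.
  by rewrite ger0_norm// (le_trans h2).
have izl : integ L zl.
  apply: (geo_integ (u := y2) (C := q ^+ 2 * lam) _ Hzl) => // x xL.
  have [_ /andP[h1 h2]] := cll x xL; have /andP[_ h3] := qb x xL.
  by rewrite ler0_norm// lerNl (le_trans _ h1)// mulNr lerN2.
have [w [w2 sw]] := step_exists yl izl.
have sl := sectorW cll.
have conv k x : 0 <= x <= L ->
    `|y k.+1 x - w x| <= r * (D * r ^+ k) * beta x /\
    `|y2 k.+1 x - w2 x| <= r * (D * r ^+ k) * (q ^+ 2 * beta x).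
  move=> xL.
  have rk : 0 <= D * r ^+ k by rewrite mulr_ge0// exprn_ge0//; case/andP: r01.
  have [ik sk] := ks k.
  have [||h1 h2] := solves_contraction L0 lam0 a0 b0 c0 EI0 gc rk ik iyl sk sl _ _
     (st k) sw xL => //.
  - by move=> t tL; rewrite mulrC mulrA; exact: Hyl.
  - move=> t /andP[/ltW t0 /ltW tL]; rewrite mulrC mulrA; apply: Hzl.
    by rewrite t0.
have eqlim (v : nat -> R) l l' K : (forall k, `|v k - l| <= K / (1 - r) * r ^+ k) ->
    (forall k, `|v k.+1 - l'| <= r * (D * r ^+ k) * K) -> l' = l.
  move=> h1 h2; apply/eqP; rewrite -subr_eq0 -normr_le0.
  apply: (geo_le0 (K := 2 * (r * D * K)) r01) => k.
  have := h1 k.+1; have := h2 k; rewrite exprS -/D => g1 g2.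
  have := ler_distD (v k.+1) l' l; rewrite (distrC l' (v k.+1)).
  lra.
have ew x : 0 <= x <= L -> w x = yl x.
  move=> xL; apply: (eqlim (fun k => y k x) _ _ (beta x)) => k; first exact: Hyl.
  by case: (conv k x xL).
have ew2 x : 0 <= x <= L -> w2 x = zl x.
  move=> xL; apply: (eqlim (fun k => y2 k x) _ _ (q ^+ 2 * beta x)) => k; first exact: Hzl.
  by case: (conv k x xL).
exists w, w2; split.
- apply: solves_ext sw => x /andP[/ltW x0 /ltW xL].
  have ei : int0 L w = int0 L yl by apply: int0_ext => t; exact: ew.
  by rewrite /load ei ew2 ?x0.
- by have [cy _] := solves_cwi sw; exact: cwi_integrable.
- by move=> x xL; rewrite ew// ew2//; exact: cll.
Qed.

End iter.
End fixed_point.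

(** * Positivity, and fixed points as solutions of the boundary value problem *)

Section solutions.
Context {R : realType}.
Implicit Types (x : R) (f g F w : R -> R) (k : nat).

(** The chord from an interior zero to either end has slope zero. As [w1] is nonincreasing, [w]
    cannot be positive on the other side of the zero. *)
Lemma concave_zero L w w1 w2 x : prim L w w1 -> prim L w1 w2 -> cwi L w -> cwi L w1 ->
  cwi L w2 -> w 0 = 0 -> w L = 0 -> (forall x, 0 <= x <= L -> w2 x <= 0) ->
  (forall x, 0 <= x <= L -> 0 <= w x) -> 0 < x < L -> w x = 0 ->
  forall y, 0 <= y <= L -> w y = 0.
Proof.
move=> p0 p1 c0 c1 c2 w0 wL neg pos /andP[x0 xL] wx y yL.
have d0 z (h : 0 < z < L) := prim_is_derive c1 p0 h.
have d1 z (h : 0 < z < L) := prim_is_derive c2 p1 h.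
have w1d (s t : R) : 0 < s -> s < t -> t < L -> w1 t <= w1 s.
  move=> s0 st tL; have [z /andP[sz zt] E] := MVT_on c1 d1 (ltW s0) st (ltW tL).
  rewrite -subr_le0 E mulr_le0_ge0 ?subr_ge0 ?(ltW st)// neg//.
  by rewrite (ltW (lt_trans s0 sz)) (ltW (lt_trans zt tL)).
apply/eqP; rewrite eq_le pos// andbT; move: yL => /andP[y0 yL].
have [yx|xy|->] := ltgtP y x; last by rewrite wx.
  have [s /andP[ys sx] Es] := MVT_on c0 d0 y0 yx (ltW xL).
  have [t /andP[xt tL] Et] := MVT_on c0 d0 (ltW x0) xL (lexx L).
  have s0 := le_lt_trans y0 ys.
  have t1 : w1 t = 0.
    move: Et; rewrite wL wx subrr => /esym/eqP; rewrite mulf_eq0 subr_eq0 (gt_eqF xL) orbF.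
    by move/eqP.
  have := w1d _ _ s0 (lt_trans sx xt) tL; rewrite t1 => ws.
  have : 0 <= w1 s * (x - y) by rewrite mulr_ge0// subr_ge0 ltW.
  by rewrite -Es wx sub0r oppr_ge0.
have [s /andP[s0 sx] Es] := MVT_on c0 d0 (lexx 0) x0 (ltW xL).
have [t /andP[xt ty] Et] := MVT_on c0 d0 (ltW x0) xy yL.
have s1 : w1 s = 0.
  move: Es; rewrite w0 wx subrr => /esym/eqP; rewrite mulf_eq0 subr_eq0 (gt_eqF x0) orbF.
  by move/eqP.
have := w1d _ _ s0 (lt_trans sx xt) (lt_le_trans ty yL); rewrite s1 => wt.
move: Et; rewrite wx subr0 => ->.
by rewrite mulr_le0_ge0// subr_ge0 ltW.
Qed.

Lemma cwi_zero L f : 0 < L -> cwi L f -> (forall x, 0 < x < L -> f x = 0) ->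
  f 0 = 0 /\ f L = 0.
Proof.
move=> L0 cf f0; have /(continuous_within_itvP f L0)[_ cr cl] := cf.
split.
  apply: (cvg_unique _ cr); first exact: Rhausdorff.
  apply: cvg_near_cst; near=> x; apply: f0; apply/andP; split; near: x.
    exact: nbhs_right_gt.
  exact: nbhs_right_lt.
apply: (cvg_unique _ cl); first exact: Rhausdorff.
apply: cvg_near_cst; near=> x; apply: f0; apply/andP; split; near: x.
  exact: nbhs_left_gt.
exact: nbhs_left_lt.
Unshelve. all: by end_near. Qed.

Lemma int0_eq0_ae L f : integ L f ->
  {ae lebesgue_measure, forall x, 0 < x < L -> 0 <= f x} -> int0 L f = 0 ->
  {ae lebesgue_measure, forall x, 0 < x < L -> f x = 0}.
Proof.
move=> fi f0 If.
have i1 : lebesgue_measure.-integrable `]0, L] (EFin \o f).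
  apply: integrableS fi => // y /=; rewrite !in_itv/= => /andP[/ltW -> ->]//.
have i2 : lebesgue_measure.-integrable `]0, L[ (EFin \o f).
  apply: integrableS fi => // y /=; rewrite !in_itv/= => /andP[/ltW -> /ltW ->]//.
have mf : measurable_fun `]0, L[ f by apply/measurable_EFinP; case/integrableP: i2.
have E : (\int[lebesgue_measure]_(x in `]0%R, L[) (f x)%:E =
    \int[lebesgue_measure]_(x in `]0%R, L[) `|(f x)%:E|)%E.
  apply: ae_eq_integral => //.
  - exact/measurable_EFinP.
  - by apply: measurableT_comp => //; exact/measurable_EFinP.
  - apply: aeS f0 => x h /=; rewrite in_itv/= => xL.
    by rewrite /= ger0_norm// h.
move: If; rewrite /int0 -Rintegral_itv_obnd_cbnd// -Rintegral_itv_bndo_bndc// /Rintegral => If.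
have If0 : (\int[lebesgue_measure]_(x in `]0%R, L[) (f x)%:E = 0)%E.
  by rewrite -[LHS]fineK ?If//; exact: integrable_fin_num.
rewrite E in If0.
have : ae_eq (@lebesgue_measure R) `]0, L[%classic (EFin \o f) (cst 0%E).
  by apply/ae_eq_integral_abs => //; exact/measurable_EFinP.
apply: aeS => x /=; rewrite in_itv/= => g xL.
by have [] := g xL.
Qed.

Section final.
Variables (a b c EI L lam : R) (p : R -> R).
Hypotheses (L0 : 0 < L) (lam0 : 0 < lam) (EI0 : 0 < EI).
Let M := a + 2 * b * lam * L / pi.
Let N := c + b * lam * pi ^+ 2 / L ^+ 2.

(** The terms added to [a] and [c] reappear in [load], so they cancel when both sides are taken at
    the same function. *)
Lemma solves_Pop w w2 w4 x :
  (w4 x - M * w2 x + N * int0 L w = load b EI L lam p w w2 x) <->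
  Pop a b c L w w2 w4 x = p x / EI.
Proof.
have key : Pop a b c L w w2 w4 x - p x / EI =
  w4 x - M * w2 x + N * int0 L w - load b EI L lam p w w2 x.
  by rewrite /Pop /load /M /N; genpi; field; rewrite !gt_eqF.
by split=> h; apply/eqP; rewrite -subr_eq0 ?key ?h ?subrr// -key h subrr.
Qed.

Lemma iteration_steps (y y2 : nat -> R -> R) : iteration a b c EI L lam p y y2 ->
  forall k, solves M N L (load b EI L lam p (y k) (y2 k)) (y k.+1) (y2 k.+1).
Proof.
move=> it k; have [w1 [w3 [w4 [W /(_ isT)[B E]]]]] := it k.+1.
by exists w1, w3, w4.
Qed.

Lemma steps_iteration (y y2 : nat -> R -> R) w1 w3 w4 : W41 L (y 0%N) w1 (y2 0%N) w3 w4 ->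
  (forall k, solves M N L (load b EI L lam p (y k) (y2 k)) (y k.+1) (y2 k.+1)) ->
  iteration a b c EI L lam p y y2.
Proof.
move=> W st; rewrite /iteration => -[|k]; first by exists w1, w3, w4.
by have [v1 [v3 [v4 [V B E]]]] := st k; exists v1, v3, v4.
Qed.

(** An interior zero makes [u] vanish by concavity, and then [u2] and [u3] too. So [u4] has integral
    zero, while the equation reads [u4 = p / EI >= 0]; hence [p] would vanish almost everywhere. *)
Lemma solution_gt0 u u1 u2 u3 u4 :
  {ae lebesgue_measure, forall x, 0 < x < L -> 0 <= p x} ->
  ~ {ae lebesgue_measure, forall x, 0 < x < L -> p x = 0} ->
  W41 L u u1 u2 u3 u4 -> hinged_bc L u u2 ->
  {ae lebesgue_measure, forall x, 0 < x < L -> Pop a b c L u u2 u4 x = p x / EI} ->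
  (forall x, 0 <= x <= L -> 0 <= u x) -> (forall x, 0 <= x <= L -> u2 x <= 0) ->
  forall x, 0 < x < L -> 0 < u x.
Proof.
move=> p0 pn0 W [u0 [uL _]] E upos uneg x xL.
have L0' := ltW L0.
have xL' : 0 <= x <= L by case/andP: xL => *; rewrite !ltW.
rewrite lt_neqAle upos// andbT; apply/negP => /eqP/esym ux; apply: pn0.
have [q0 q1 q2 q3] := W41_prim W; have [c0 c1 c2 c3] := W41_cwi L0' W.
have z := concave_zero q0 q1 c0 c1 c2 u0 uL uneg upos xL ux.
have z' t : 0 < t < L -> u t = 0 by move=> /andP[/ltW ? /ltW ?]; apply: z; apply/andP.
have [zp _ _ _] := W41_prim (W41_0 L).
have cz := @cwi_cst R L 0.
have z1 := derive_unique c1 cz q0 zp z'.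
have z2 := derive_unique c2 cz q1 zp z1.
have z3 := derive_unique c3 cz q2 zp z2.
have [e0 eL] := cwi_zero L0 c3 z3.
have iu : int0 L u = 0.
  by rewrite (int0_ext (g := fun=> 0) z) int0_cst// mul0r.
have i4 : int0 L u4 = 0.
  by have := q3 L; rewrite lexx L0' e0 eL add0r => /(_ isT).
have [u4i _] := W.
have e4 : {ae lebesgue_measure, forall t, 0 < t < L -> u4 t = p t / EI}.
  apply: aeS E => t e tL; rewrite -(e tL) /Pop iu z2//; ring.
have u4p : {ae lebesgue_measure, forall t, 0 < t < L -> 0 <= u4 t}.
  by apply: aeS2 e4 p0 => t h1 h2 tL; rewrite h1// divr_ge0 ?h2// ltW.
have := int0_eq0_ae u4i u4p i4; move=> /(aeS2 _ e4); apply=> t h1 h2 tL.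
have := h2 tL; rewrite h1// => /eqP; rewrite mulf_eq0 invr_eq0 (gt_eqF EI0) orbF.
by move/eqP.
Qed.

End final.
End solutions.

Unset Implicit Arguments.
Theorem theorem6p1 (R : realType) (L EI H EcAc Lc n : R) (p : R -> R) :
  0 < L -> 0 < EI -> 0 < H -> 0 < EcAc -> 0 < Lc -> 0 < n ->
  let a := H / EI in
  let b := (8 * n / L) * (EcAc / (EI * Lc)) in
  let c := (8 * n / L) * b in
  let lam := L / 100 in
  let beta := fun x : R => L / 100 * sin (pi / L * x) in
  (lebesgue_measure).-integrable `[0, L] (EFin \o p) ->
  {ae lebesgue_measure, forall x, 0 < x < L -> 0 <= p x} ->
  ~ {ae lebesgue_measure, forall x, 0 < x < L -> p x = 0} ->
  {ae lebesgue_measure, forall x, 0 < x < L ->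
     p x / EI <= (lam * pi ^+ 4 / L ^+ 4 + a * lam * pi ^+ 2 / L ^+ 2
                  + 2 * b * lam ^+ 2 * pi / L) * sin (pi / L * x)
                 + 2 * lam * c * L / pi} ->
  is_lower_solution a b c EI L p (fun _ => 0) /\
  is_upper_solution a b c EI L p beta /\
  (let M := a + c * L ^+ 3 / (400 * n * pi) in
   let N := c * (1 + pi ^+ 2 / (800 * n)) in
   1 / (1532 / 100) <= n ->
   N <= 4 * M / L ^+ 3 * sigma (Num.sqrt M * L) ->
   exists u : R -> R,
     [/\ is_solution a b c EI L p u,
         (forall x, 0 < x < L -> 0 < u x),
         (exists u1 u2 u3 u4, W41 L u u1 u2 u3 u4 /\
            forall x, 0 <= x <= L ->
              0 <= u x <= beta x /\
              - (pi / L) ^+ 2 * beta x <= u2 x <= 0),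
         (forall v, is_solution a b c EI L p v ->
            (exists v1 v2 v3 v4, W41 L v v1 v2 v3 v4 /\
               forall x, 0 <= x <= L ->
                 0 <= v x <= beta x /\
                 - (pi / L) ^+ 2 * beta x <= v2 x <= 0) ->
            forall x, 0 <= x <= L -> v x = u x) &
         forall y0 : R -> R, (y0 = (fun _ => 0) \/ y0 = beta) ->
           (exists y y2 : nat -> R -> R,
              y 0%N = y0 /\ iteration a b c EI L lam p y y2) /\
           (forall y y2 : nat -> R -> R,
              y 0%N = y0 -> iteration a b c EI L lam p y y2 ->
              unif_cv_on L y u)]).
Proof.
move=> L0 EI0 H0 A0 Lc0 n0 a b c lam beta ip p0 pn0 pub.
have a0 : 0 < a by exact: divr_gt0.
have b0 : 0 < b.
  by apply: mulr_gt0; apply: divr_gt0 => //; apply: mulr_gt0.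
have c0 : 0 < c by apply: mulr_gt0 => //; apply: divr_gt0 => //; apply: mulr_gt0.
have lam0 : 0 < lam by exact: divr_gt0.
have L0' := ltW L0.
split; [|split].
- exists (fun=> 0), (fun=> 0), (fun=> 0), (fun=> 0); split; first exact: W41_0.
  split; first by [].
  apply: aeS p0 => x px xL; rewrite /Pop int0_cst// mul0r !mulr0 subrr addr0.
  by rewrite divr_ge0 ?px// ltW.
- eexists _, _, _, _; split; first exact: (W41_arch lam L).
  split; first exact: hinged_arch.
  apply: aeS pub => x px xL; apply: le_trans (px xL) _.
  (* The bound on [p / EI] is exactly [Pop] at [beta], so an identity is left to prove. *)
  rewrite /Pop -/lam (int_arch lam L0) /arch; move: (sin _) => S.
  rewrite le_eqVlt; apply/orP; left; apply/eqP; move: (a) (b) (c) (lam) => a' b' c' lam'.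
  by genpi; field; rewrite !gt_eqF.
move=> M N _ NM.
(* With [c = 8 n b / L] and [lam = L / 100] the constants of the statement are those of the
   iteration. *)
have eM : M = a + 2 * b * lam * L / pi.
  rewrite /M /c /lam; move: (a) (b) => a' b'; genpi.
  by field; rewrite !gt_eqF.
have eN : N = c + b * lam * pi ^+ 2 / L ^+ 2.
  rewrite /N /c /lam; move: (a) (b) => a' b'; genpi.
  by field; rewrite !gt_eqF.
have M0 : 0 < M.
  rewrite eM; apply: addr_gt0 => //; apply: divr_gt0; last exact: pi_gt0.
  by do 3! apply: mulr_gt0 => //.
have N0 : 0 < N.
  rewrite eN; apply: addr_gt0 => //; apply: divr_gt0; last exact: exprn_gt0.
  by apply: mulr_gt0; [exact: mulr_gt0|apply: exprn_gt0; exact: pi_gt0].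
have gc := sigma_green_cond M0 L0 N0 NM.
rewrite eM eN in gc.
clear NM M0 N0 eM eN.
have r01 : 0 <= rate a b c L lam < 1 by rewrite rate_ge0//= rate_lt1.
have bb x : 0 <= x <= L -> 0 <= beta x <= lam by exact: arch_bounds.
have [u [u2 [stu iu clu]]] := fixed_exists L0 lam0 a0 b0 c0 EI0 gc ip p0 pub.
have su : sector lam L u u2 by exact: sectorW clu.
have [u1 [u3 [u4 [U B E]]]] := stu.
have E' : {ae lebesgue_measure, forall x, 0 < x < L -> Pop a b c L u u2 u4 x = p x / EI}.
  by apply: aeS E => x e xL; exact: (solves_Pop a b c lam p L0 EI0 u u2 u4 x).1 (e xL).
have dist y y2 := @fixed_dist _ _ _ _ _ _ _ _ L0 lam0 a0 b0 c0 EI0 gc p0 pub u u2 y y2 iu su stu.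
exists u; split.
- by exists u1, u2, u3, u4.
- apply: (solution_gt0 L0 EI0 p0 pn0 U B E') => x xL; have [] := clu x xL.
    by move=> /andP[].
  by move=> _ /andP[].
- by exists u1, u2, u3, u4; split.
- move=> v [v1 [v2 [v3 [v4 [V [Bv Ev]]]]]] [w1 [w2 [w3 [w4 [W clv]]]]] x xL.
  have sv : sector lam L v v2.
    split=> t tL; first by case: (clv t tL).
    rewrite (W41_unique2 L0' V W tL); move: tL => /andP[/ltW t0 /ltW tL].
    by case: (clv t); rewrite ?t0.
  have iv : lebesgue_measure.-integrable `[0, L] (EFin \o v).
    by have [cv _ _ _] := W41_cwi L0' V; exact: cwi_integrable.
  have stv : solves (a + 2 * b * lam * L / pi) (c + b * lam * pi ^+ 2 / L ^+ 2) L
      (load b EI L lam p v v2) v v2.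
    exists v1, v3, v4; split=> //.
    by apply: aeS Ev => t e tL; exact: (solves_Pop a b c lam p L0 EI0 v v2 v4 t).2 (e tL).
  (* As a constant iteration, [v] is within [r^k beta] of [u] for every [k]. *)
  apply/eqP; rewrite -subr_eq0 -normr_le0.
  apply: (geo_le0 (K := beta x) r01) => k; rewrite mulrC.
  exact: (dist (fun=> v) (fun=> v2) iv sv (fun=> stv) k x xL).
- move=> y0 y0E.
  (* Both starting functions are extreme elements of the sector. *)
  have [z1 [z2 [z3 [z4 [Z clz]]]]] : exists z1 z2 z3 z4, W41 L y0 z1 z2 z3 z4 /\
      sector lam L y0 z2.
    case: y0E => ->.
      exists (fun=> 0), (fun=> 0), (fun=> 0), (fun=> 0); split; first exact: W41_0.
      apply: sectorW => x xL; have /andP[b1 _] := bb x xL.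
      split=> /=; first by rewrite lexx.
      by rewrite lexx andbT mulNr oppr_le0 mulr_ge0// sqr_ge0.
    eexists _, _, _, _; split; first exact: (W41_arch lam L).
    apply: sectorW => x xL; have /andP[b1 _] := bb x xL.
    split; first by rewrite b1 lexx.
    by rewrite lexx /= mulNr oppr_le0 mulr_ge0// sqr_ge0.
  have [cz _ cz2 _] := W41_cwi L0' Z.
  split.
    have [y [y2 [e0 e20 st]]] := steps_exist EI L0 lam0 a0 b0 c0 gc ip y0 (cwi_integrable cz2).
    exists y, y2; split=> //; apply: steps_iteration st.
    by rewrite e0 e20; exact: Z.
  move=> y y2 e0 it e e_gt0.
  have st := iteration_steps it.
  have [w1 [w3 [w4 [W _]]]] := it 0%N.
  have iy : lebesgue_measure.-integrable `[0, L] (EFin \o y 0%N).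
    by rewrite e0; exact: cwi_integrable.
  (* [iteration] leaves the witness [y2 0] open; at interior points it must be the known [z2]. *)
  have sy : sector lam L (y 0%N) (y2 0%N).
    case: clz => s1 s2; split=> x xL; first by rewrite e0; exact: s1.
    by rewrite e0 in W; rewrite (W41_unique2 L0' W Z xL); exact: s2.
  have [m Hm] := geo_small lam r01 e_gt0.
  exists m => k mk x xL; apply: le_lt_trans (Hm k mk); rewrite mulrC.
  apply: le_trans (dist y y2 iy sy st k x xL) _.
  have /andP[r0 _] := r01; have /andP[_ b2] := bb x xL.
  by rewrite ler_wpM2l// exprn_ge0.
Qed.
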